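(* In Barron's model $(\mathbb F,\Pi)$, when the data-generating density is the uniform density $f_\star=f_0\equiv1$ on $[0,1)$, the posterior is $\ln 2$-inconsistent; that is, $$\limsup_{n\to\infty}\Pi\big(\{f\in\mathbb F:R_n(f)=2^n\}\mid X_{1:n}\big)=1\quad\text{almost surely.}$$
   Context: Barron's model. Let $\mathbb X=[0,1)$ with its Euclidean topology and Borel $\sigma$-algebra, and let $\lambda$ be Lebesgue measure. Let $\Phi$ be the standard normal cumulative distribution function. Let $\mathbb F:=\mathbb F_0\cup\mathbb F_\triangle$, equipped with the Borel $\sigma$-algebra of the topology of weak convergence of the corresponding probability measures, where: - $\mathbb F_0:=\{f_\theta:\theta\in[0,1]\}$ with $f_\theta(x):=\exp\{-\theta+\sqrt{2\theta}\,\Phi^{-1}(x)\}$; in particular $f_0\equiv1$ is the uniform density on $[0,1)$. - $\mathbb F_\triangle:=\bigcup_{N\in\mathbb N}\mathbb F_N$ with $\mathbb N=\{1,2,\dots\}$, where, with $P_N:=\{[\tfrac{j}{2N^2},\tfrac{j+1}{2N^2}):j=0,1,\dots,2N^2-1\}$ the partition of $[0,1)$ into $2N^2$ consecutive intervals of equal length, $\mathbb F_N$ is the collection of all $\binom{2N^2}{N^2}$ densities taking the constant value $2$ on exactly $N^2$ of the intervals in $P_N$ and the value $0$ on the remaining $N^2$ intervals. The prior is $\Pi=\tfrac12\Pi_0+\tfrac12\Pi_\triangle$, where $\Pi_0$ is the probability measure on $\mathbb F_0$ induced, via $\theta\mapsto f_\theta$, by the distribution on $\theta$ proportional to $e^{-1/\theta}1_{[0,1]}(\theta)\,\mathrm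 d\theta$, and $\Pi_\triangle$ is the probability measure on $\mathbb F_\triangle$ given by $$\Pi_\triangle(\mathrm df)\propto\sum_{N\in\mathbb N}\frac1{N^2}\sum_{g\in\mathbb F_N}\frac1{\binom{2N^2}{N^2}}\,\delta_g(\mathrm df).$$ Data and posterior. $X_1,X_2,\dots$ are iid from the distribution $F_\star$ with density $f_\star$; ''almost surely'' refers to the product measure $F_\star^\infty$. The likelihood ratio is $R_n(f):=\prod_{i=1}^n f(X_i)/f_\star(X_i)$ and the posterior is $\Pi(\mathrm df\mid X_{1:n})=R_n(f)\,\Pi(\mathrm df)/\int_{\mathbb F}R_n(g)\,\Pi(\mathrm dg)$. $\gamma$-inconsistency. For $\gamma>0$, the posterior is $\gamma$-inconsistent if $\limsup_{n\to\infty}\Pi(\{f\in\mathbb F:R_n(f)=e^{\gamma n}\}\mid X_{1:n})=1$ almost surely. *)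

(* Defs.v *)
From HB Require Import structures.
From mathcomp Require Import all_boot all_order all_algebra finmap.
From mathcomp Require Import all_classical all_reals all_analysis.
From mathcomp Require Import measurable_realfun lra ring.

Set Implicit Arguments.
Unset Strict Implicit.
Unset Printing Implicit Defensive.

Import Order.TTheory GRing.Theory Num.Theory.
Import numFieldNormedType.Exports.

Local Open Scope classical_set_scope.
Local Open Scope ring_scope.

(* The sample space [0, 1) is represented inside R: integrals are taken over
   `[0, 1[ with respect to lebesgue_measure, and densities are extended by 0
   outside `[0, 1[. *)

Section densities.
Context {R : realType}.

Definition Phi (z : R) : R := fine (normal_prob 0 1 `]-oo, z]).

(* Generalized inverse of Phi, with values in the extended reals because
   PhiInv 0 = -oo. *)
Definition PhiInv (x : R) : \bar R :=
  ereal_inf [set z%:E | z in [set z | x <= Phi z]].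

(* Only at x = 0 is PhiInv x infinite; there the conventions 0 * -oo = 0 and
   expeR -oo = 0 give f_theta 0 0 = 1 and f_theta t 0 = 0 for t > 0. In
   particular f_theta 0 is identically 1 on `[0, 1[. *)
Definition f_theta (t : R) (x : R) : R :=
  if x \in `[0, 1[ then
    fine (expeR ((- t)%:E + (Num.sqrt (2 * t))%:E * PhiInv x)%E)
  else 0.

Definition F_zero : set (R -> R) := [set f_theta t | t in `[0, 1]].

Definition cell (N j : nat) : set R :=
  `[j%:R / (2 * N ^ 2)%:R, j.+1%:R / (2 * N ^ 2)%:R[.

Definition two_on (N : nat) (S : {set 'I_(2 * N ^ 2)}) : R -> R :=
  fun x => 2 * \1_(\bigcup_(j in [set` S]) cell N j) x.

Definition F_part (N : nat) : set (R -> R) :=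
  [set two_on S | S in [set S : {set 'I_(2 * N ^ 2)} | #|S| = (N ^ 2)%N]].

Definition F_triangle : set (R -> R) :=
  \bigcup_(N in [set N | (1 <= N)%N]) F_part N.

End densities.

(* The parameter space F = F_zero U F_triangle. *)
Definition density (R : realType) : Type :=
  {f : R -> R | (F_zero `|` F_triangle) f}.

Definition dens (R : realType) (f : density R) : R -> R := sval f.
Coercion dens : density >-> Funclass.

Section density_borel.
Context {R : realType}.

(* The parametrization t |-> f_t of F_zero is made total by first projecting R
   onto [0, 1]; the law put on t below does not charge the rest of R. *)
Definition clamp (t : R) : R := Num.max 0 (Num.min t 1).

Lemma clamp_itv t : clamp t \in `[0, 1].
Proof.
by rewrite in_itv/= /clamp le_max lexx/= ge_max ler01/= ge_min lexx orbT.
Qed.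

Lemma f_theta_mem t : (F_zero `|` F_triangle) (f_theta (clamp t)).
Proof. by left; exists (clamp t) => //=; exact: clamp_itv. Qed.

Definition F0_param (t : R) : density R := exist _ _ (f_theta_mem t).

HB.instance Definition _ := gen_eqMixin (density R).
HB.instance Definition _ := gen_choiceMixin (density R).
HB.instance Definition _ := isPointed.Build (density R) (F0_param 0).

Definition bounded_continuous : set (R -> R) :=
  [set h : R -> R | {within `[0, 1[, continuous h} /\
    exists M : R, forall x, x \in `[0, 1[ -> `|h x| <= M].

(* The integral of h against the probability measure with density f. *)
Definition test_integral (h : {h : R -> R | bounded_continuous h})
    (f : density R) : R :=
  (\int[lebesgue_measure]_(x in `[0%R, 1%R[) (sval h x * f x))%R.

(* The coarsest topology making every test_integral h continuous, i.e. the
   topology of weak convergence; density R carries its Borel sigma-algebra. *)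
Definition weak_convergence_topology := sup_topology (fun h =>
  Topological.class (initial_topology (test_integral h))).

HB.instance Definition _ := Topological.copy (density R)
  weak_convergence_topology.

HB.instance Definition _ := Measurable.copy (density R)
  (g_sigma_algebraType (@open (density R))).

End density_borel.

Section quantile_theory.
Context {R : realType}.
Local Notation N01 := (normal_prob (0:R) 1).
Local Notation mu := (@lebesgue_measure R).

Let idTR : measurableTypeR R -> R := idfun.
#[local] HB.instance Definition _ :=
  @isMeasurableFun.Build _ _ _ _ idTR (@measurable_id _ _ setT).
Let idN : {RV N01 >-> R} := idTR.

Let PhiE z : (Phi z)%:E = cdf idN z.
Proof.
by rewrite /Phi fineK ?fin_num_measure//; rewrite /cdf /distribution /pushforward preimage_id.
Qed.

Let Phi_fine : Phi = fine \o cdf idN.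
Proof. by apply/funext => z; rewrite [RHS]/comp -PhiE. Qed.

Lemma Phi_nondecreasing : nondecreasing_fun (@Phi R).
Proof.
by move=> x y xy; rewrite -lee_fin !PhiE; exact: (@cdf_nondecreasing _ _ _ N01 idN).
Qed.

Lemma PhiInv_le (x z : R) : (PhiInv x <= z%:E)%E = (x <= Phi z).
Proof.
apply/idP/idP => [h|xz]; last by apply: ereal_inf_lbound; exists z.
have rc : Phi y @[y --> z^'+] --> Phi z.
  have := @cdf_right_continuous _ _ _ N01 idN z.
  rewrite -PhiE => /fine_cvg; rewrite Phi_fine /=; exact: cvg_trans.
apply: (cvgr_to_ge rc).
near=> y.
have : (PhiInv x < y%:E)%E.
  by rewrite (le_lt_trans h)// lte_fin.
move=> /ereal_inf_lt[_ [w xw <-]]; rewrite lte_fin => wy.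
by rewrite (le_trans xw)// Phi_nondecreasing// ltW.
Unshelve. all: by end_near. Qed.

Lemma PhiInv_fin (x : R) : x \in `]0, 1[ -> PhiInv x \is a fin_num.
Proof.
rewrite in_itv/= => /andP[x0 x1]; rewrite fin_numE; apply/andP; split.
  have : exists z, Phi z < x.
    have h : @Phi R @ -oo --> (0 : R).
      by rewrite Phi_fine; exact/fine_cvg/cvg_cdfNy0.
    by have [M [Mr hM]] := cvgr_lt _ h _ x0; exists (M - 1); apply: hM; lra.
  move=> [z zx]; apply/eqP => h.
  by have := PhiInv_le x z; rewrite h leNye leNgt zx.
have : exists z, x < Phi z.
  have h : @Phi R @ +oo --> (1 : R).
    by rewrite Phi_fine; exact/fine_cvg/cvg_cdfy1.
  by have [M [Mr hM]] := cvgr_gt _ h _ x1; exists (M + 1); apply: hM; lra.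
move=> [z zx]; apply/eqP => h.
by have := PhiInv_le x z; rewrite h (ltW zx).
Qed.

Definition quantile (x : R) : R := fine (PhiInv x).

Lemma measurable_qu : measurable_fun (`]0, 1[ : set R) quantile.
Proof.
apply: (measurability (@RGenOInfty.G R)); first exact: RGenOInfty.measurableE.
move=> _ [_ [z ->] <-].
have -> : `]0, 1[ `&` quantile @^-1` `]z, +oo[ = `]0, 1[ `&` `]Phi z, +oo[%classic.
  apply/seteqP; split => x [x01 /=]; rewrite !in_itv/= !andbT => h; split => //.
    by rewrite ltNge -PhiInv_le -(fineK (PhiInv_fin x01)) lee_fin -ltNge.
  by rewrite ltNge -lee_fin fineK ?PhiInv_fin// PhiInv_le -ltNge.
exact: measurableI.
Qed.

Let qT : R -> R := quantile \_ (`]0, 1[ : set R).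
Let mqT : measurable_fun setT qT.
Proof. by apply/(measurable_restrictT quantile) => //; exact: measurable_qu. Qed.

Local Notation U := (uniform_prob (@ltr01 R)).

Let qTR : measurableTypeR R -> measurableTypeR R := qT.
#[local] HB.instance Definition _ := @isMeasurableFun.Build _ _ _ _ qTR mqT.


Let U_qT (z : R) : U (qT @^-1` `]-oo, z]) = (Phi z)%:E.
Proof.
have mA : measurable (qT @^-1` `]-oo, z]).
  by rewrite -[X in measurable X]setTI; exact: mqT.
have mB : measurable (`]0, 1[ `&` `]-oo, Phi z] : set R) by exact: measurableI.
rewrite /uniform_prob integral_uniform_pdf.
rewrite (_ : (\int[_]_(x in _) _)%E = mu (qT @^-1` `]-oo, z] `&` `[0, 1])); last first.
  rewrite (eq_integral (cst 1%E)); last first.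
    move=> x; rewrite inE/= => -[_]; rewrite in_itv/= /uniform_pdf => ->.
    by rewrite subr0 invr1.
  by rewrite integral_cst ?mul1e//; exact: measurableI.
have BA : `]0, 1[ `&` `]-oo, Phi z] `<=` qT @^-1` `]-oo, z] `&` `[0, 1].
  move=> x [x01 xz]; split; last first.
    by move: x01; rewrite /= !in_itv/= => /andP[/ltW -> /ltW ->].
  rewrite /= /qT patchE mem_set// in_itv/= -lee_fin fineK ?PhiInv_fin//.
  by rewrite PhiInv_le; move: xz; rewrite /= in_itv.
have AB : qT @^-1` `]-oo, z] `&` `[0, 1] `<=`
    (`]0, 1[ `&` `]-oo, Phi z]) `|` [set 0; 1].
  move=> x [xz x01]; have [->|x0] := eqVneq x 0; first by right; left.
  have [->|x1] := eqVneq x 1; first by right; right.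
  have x01' : x \in `]0, 1[.
    move: x01; rewrite /= !in_itv/= => /andP[? ?].
    by rewrite !lt_neqAle x1 eq_sym x0 /=; apply/andP.
  left; split => //; move: xz; rewrite /= /qT patchE mem_set// !in_itv/=.
  by rewrite -PhiInv_le -lee_fin fineK ?PhiInv_fin.
have m01 : mu [set 0; 1] = 0.
  by apply: countable_lebesgue_measure0; exact: finite_set_countable.
have -> : mu (qT @^-1` `]-oo, z] `&` `[0, 1]) = mu (`]0, 1[ `&` `]-oo, Phi z]).
  apply/eqP; rewrite eq_le; apply/andP; split; last first.
    by apply: le_measure => //; rewrite inE//; exact: measurableI.
  apply: (@le_trans _ _ (mu ((`]0, 1[ `&` `]-oo, Phi z]) `|` [set 0; 1]))).
    apply: le_measure => //; rewrite inE//; first exact: measurableI.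
    by apply: measurableU => //; exact: measurableU.
  apply: (le_trans (measureU2 _ _ _)) => //; first exact: measurableU.
  by rewrite [X in (_ + X <= _)%E]m01 adde0.
have P0 : 0 <= Phi z by rewrite -lee_fin PhiE; exact: cdf_ge0.
have P1 : Phi z <= 1 by rewrite -lee_fin PhiE; exact: cdf_le1.
have [P1'|P1'] := ltP (Phi z) 1.
  rewrite (_ : _ `&` _ = `]0, Phi z]%classic); last first.
    apply/seteqP; split => x /=; rewrite !in_itv/=; first by move=> [/andP[-> _] ->].
    by move=> /andP[-> h]; rewrite h (le_lt_trans h).
  rewrite lebesgue_measure_itv/= lte_fin; case: ltP => [_|P0']; first by rewrite sube0.
  by congr (_%:E); apply/eqP; rewrite eq_le P0 P0'.
rewrite setIidl; last first.
  by move=> x; rewrite /= !in_itv/= => /andP[_ /ltW /le_trans]; apply.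
rewrite lebesgue_measure_itv/= lte_fin ltr01 sube0; congr (_%:E).
by apply/eqP; rewrite eq_le P1 P1'.
Qed.

Let distribution_qu A : measurable A -> distribution U qTR A = N01 A.
Proof.
have E z : distribution U qTR `]-oo, z] = N01 `]-oo, z].
  by rewrite [LHS]U_qT PhiE /cdf /distribution /pushforward preimage_id.
move=> mA.
apply: (@measure_unique _ R (measurableTypeR R) (@RGenOInfty.G R)
  (fun n => `]- n%:R, +oo[%classic) _ _ _ _ (distribution U qTR) N01) => //.
- exact: RGenOInfty.measurableE.
- move=> _ _ [x ->] [y ->]; exists (Num.max x y); apply/seteqP; split => z /=.
    by rewrite !in_itv/= !andbT gt_max => -[-> ->].
  by rewrite !in_itv/= !andbT gt_max => /andP[-> ->].
- by move=> n; eexists.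
- apply/seteqP; split => // x _; exists (Num.bound `|- x|) => //=.
  by rewrite in_itv/= andbT ltrNl (le_lt_trans _ (archi_boundP (normr_ge0 (- x))))// ?ler_norm.
- move=> _ [z ->]; rewrite -setCitvl.
  transitivity (1 - distribution U qTR `]-oo, z])%E; first exact: probability_setC.
  by rewrite E; apply/esym; exact: probability_setC.
- move=> k; apply: (le_lt_trans (probability_le1 _ _)) => //; exact: ltry.
Qed.

Lemma integral_N01 (g : R -> R) : measurable_fun setT g -> (forall x, 0 <= g x) ->
  (\int[N01]_x (g x)%:E = \int[mu]_x (g x * normal_pdf 0 1 x)%:E)%E.
Proof.
move=> mg g0; have dom := @normal_prob_dominates R 0 1.
rewrite -(Radon_Nikodym_SigmaFinite.change_of_variables dom)//; last first.
  exact/measurable_EFinP.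
apply: ae_eq_integral => //.
- apply: emeasurable_funM => //; first exact/measurable_EFinP.
  by apply: (measurable_int mu); exact: Radon_Nikodym_SigmaFinite.f_integrable.
- by apply/measurable_EFinP; apply: measurable_funM => //; exact: measurable_normal_pdf.
under [X in ae_eq _ _ _ X]eq_fun do rewrite EFinM.
apply: ae_eqe_mul2l; apply: integral_ae_eq => //.
- exact: Radon_Nikodym_SigmaFinite.f_integrable.
- by apply/measurable_EFinP; exact: measurable_normal_pdf.
- by move=> E _ mE; rewrite -Radon_Nikodym_SigmaFinite.f_integral.
Qed.

Lemma integral_exp_N01 (c : R) : (\int[N01]_x (expR (c * x))%:E = (expR (c ^+ 2 / 2))%:E)%E.
Proof.
rewrite integral_N01; last 2 first.
- by apply: measurableT_comp => //; exact: measurable_funM.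
- by move=> x; exact: expR_ge0.
transitivity (\int[mu]_x ((expR (c ^+ 2 / 2))%:E * (normal_pdf c 1 x)%:E))%E.
  apply: eq_integral => x _; rewrite -EFinM; congr (_%:E).
  rewrite !normal_pdfE ?oner_eq0// mulrCA [RHS]mulrCA; congr (_ * _).
  by rewrite -!expRD; congr expR; rewrite /normal_fun; field.
rewrite ge0_integralZl_EFin ?expR_ge0//.
- by rewrite integral_normal_pdf mule1.
- by move=> x _; rewrite lee_fin normal_pdf_ge0.
- by apply/measurable_EFinP; exact: measurable_normal_pdf.
Qed.

Lemma integrable_exp_qu (c : R) :
  mu.-integrable `]0, 1[ (fun x => (expR (c * quantile x))%:E).
Proof.
have mg : measurable_fun setT (fun x : R => expR (c * x)).
  by apply: measurableT_comp => //; exact: measurable_funM.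
apply/integrableP; split.
  by apply/measurable_EFinP; apply: (measurableT_comp mg); exact: measurable_qu.
have := integral_exp_N01 c.
have -> : (\int[N01]_x (expR (c * x))%:E = \int[distribution U qTR]_x (expR (c * x))%:E)%E.
  apply: eq_measure_integral => A mA _. exact/esym/distribution_qu.
rewrite ge0_integral_distribution//; last first.
  exact/measurable_EFinP.
rewrite integral_uniform; last 2 first.
  apply/measurable_EFinP; exact: (measurableT_comp mg mqT).
  by move=> y; rewrite lee_fin expR_ge0.
rewrite subr0 invr1 mul1e => h.
apply: (@le_lt_trans _ _ (expR (c ^+ 2 / 2))%:E); last exact: ltry.
rewrite -h.
rewrite (eq_integral (fun x => (expR (c * qTR x))%:E)); last first.
  by move=> x /[!inE] x01; rewrite gee0_abs ?lee_fin ?expR_ge0// /qTR/qT patchE mem_set.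
apply: ge0_subset_integral => //=.
- by apply/measurable_EFinP; apply/measurable_funTS; exact: (measurableT_comp mg mqT).
- by move=> x /=; rewrite !in_itv/= => /andP[/ltW -> /ltW ->].
Qed.
End quantile_theory.

Section F0_param_theory.
Context {R : realType}.
Local Notation mu := (@lebesgue_measure R).

Lemma f_thetaE (t x : R) : x \in `]0, 1[ ->
  f_theta t x = expR (- t + Num.sqrt (2 * t) * quantile x).
Proof.
move=> x01; rewrite /f_theta ifT.
  by rewrite /quantile -{1}(fineK (PhiInv_fin x01)) -EFinM -EFinD.
by move: x01; rewrite !in_itv/= => /andP[/ltW -> ->].
Qed.

Lemma ae_itvoo (Q : R -> Prop) : (forall x : R, x \in `]0, 1[ -> Q x) ->
  {ae mu, forall x, (`[0, 1[%classic : set R) x -> Q x}.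
Proof.
move=> h; exists [set 0]; split => //; first exact: lebesgue_measure_set1.
move=> x /= nh; apply: contrapT => x0; apply: nh => x01; apply: h.
move: x01; rewrite !in_itv/= => /andP[x0' ->]; rewrite andbT lt_neqAle x0' andbT.
by apply/eqP => /esym.
Qed.

Let setU01 : (`[0, 1[%classic : set R) = [set 0] `|` `]0, 1[.
Proof. by rewrite setU1itv// bnd_simp. Qed.

Let sub01 : (`]0, 1[%classic : set R) `<=` `[0, 1[.
Proof. by move=> x; rewrite /= !in_itv/= => /andP[/ltW -> ->]. Qed.

Let measurable_co (f : R -> R) : measurable_fun (`]0, 1[%classic : set R) f ->
  measurable_fun (`[0, 1[%classic : set R) f.
Proof.
by move=> mf; rewrite setU01; apply/measurable_funU => //; split => //; exact: measurable_fun_set1.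
Qed.

Let integrable_co (f : R -> R) : mu.-integrable `]0, 1[ (EFin \o f) ->
  mu.-integrable `[0, 1[ (EFin \o f).
Proof.
move=> /integrableP[/measurable_EFinP mf h]; apply/integrableP; split.
  by apply/measurable_EFinP; exact: measurable_co.
rewrite -integral_itv_obnd_cbnd//.
by apply: measurableT_comp => //; exact/measurable_EFinP.
Qed.

Lemma measurable_f_theta (t : R) :
  measurable_fun (`[0, 1[%classic : set R) (f_theta t).
Proof.
apply: measurable_co.
apply: (eq_measurable_fun (fun x => expR (- t + Num.sqrt (2 * t) * quantile x))).
  by move=> x /[!inE] x01; rewrite f_thetaE.
apply: measurableT_comp => //; apply: measurable_funD => //.
by apply: measurable_funM => //; exact: measurable_qu.
Qed.

Lemma continuous_clamp : continuous (@clamp R).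
Proof.
move=> x; apply: (@continuous_max R R (cst 0) (fun t => Num.min t 1)).
  exact: cvg_cst.
by apply: (@continuous_min R R id (cst 1)); [exact: cvg_id|exact: cvg_cst].
Qed.

Lemma f_theta_bound (t x : R) : x \in `]0, 1[ ->
  `|f_theta (clamp t) x| <= 1 + expR (Num.sqrt 2 * quantile x).
Proof.
move=> x01; rewrite f_thetaE// ger0_norm ?expR_ge0//.
have /andP[c0 c1] : 0 <= clamp t <= 1 by have := clamp_itv t; rewrite in_itv.
have [q0|q0] := leP 0 (quantile x).
  rewrite -[leLHS]add0r lerD// ler_expR -[leRHS]add0r lerD ?oppr_le0//.
  by rewrite ler_wpM2r// ler_sqrt ?mulr_ge0// ler_piMr.
rewrite -[leLHS]addr0 lerD ?expR_ge0// -[leRHS]expR0 ler_expR.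
rewrite -[leRHS]addr0 lerD ?oppr_le0//.
by rewrite mulr_ge0_le0 ?sqrtr_ge0// ltW.
Qed.

Lemma continuous_test_integral (h : {h : R -> R | bounded_continuous h}) :
  continuous (fun t : R => test_integral h (F0_param t)).
Proof.
case: h => h [ch [M hM]] a; rewrite /test_integral/=.
have mh : measurable_fun (`[0, 1[%classic : set R) h by exact: subspace_continuous_measurable_fun.
have m01 : measurable (`[0, 1[%classic : set R) by [].
pose g (x : R) := M * (1 + expR (Num.sqrt 2 * quantile x)).
have ig : mu.-integrable `[0, 1[ (EFin \o g).
  apply: integrable_co; rewrite /g.
  apply: (@integrableZl _ _ _ mu _ _ M (fun x => (1 + expR (Num.sqrt 2 * quantile x))%:E)) => //.
  apply: (@integrableD _ _ _ mu _ _ (cst 1%E) (fun x => (expR (Num.sqrt 2 * quantile x))%:E)) => //.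
  - apply/integrableP; split => //.
    under eq_integral do rewrite /cst abse1.
    rewrite integral_cst//=; rewrite mul1e lebesgue_measure_itv/= lte_fin ltr01.
    by rewrite -EFinB ltry.
  - exact: integrable_exp_qu.
have M0 : 0 <= M by rewrite (le_trans _ (hM 0 _))// in_itv/= lexx ltr01.
have h1 t x : x \in `]0, 1[ -> `|h x * f_theta (clamp t) x| <= g x.
  move=> x01; rewrite normrM ler_pM// ?f_theta_bound//.
  by apply: hM; move: x01; rewrite !in_itv/= => /andP[/ltW -> ->].
apply: (@continuity_under_integral _ _ _ mu
  (fun t x => h x * f_theta (clamp t) x) _ m01 (a - 1) (a + 1) _ _ g) => //.
- move=> t _; apply: integrable_co; apply: (@le_integrable _ _ _ mu _ _ _ (EFin \o g)) => //.
  + apply/measurable_EFinP; apply: measurable_funM.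
      by apply: measurable_funS mh => //; exact: sub01.
    apply: measurable_funS (measurable_f_theta _) => //; exact: sub01.
  + by move=> x x01; rewrite lee_fin (le_trans (h1 _ _ _))// ler_norm.
  + by apply: integrableS ig => //; exact: sub01.
- apply: ae_itvoo => x x01 t _.
  apply: (@cvgM _ _ _ _ (cst (h x)) (f_theta^~ x \o clamp)); first exact: cvg_cst.
  rewrite f_thetaE//.
  rewrite (_ : (f_theta^~ x \o clamp) = fun t => expR (- clamp t + Num.sqrt (2 * clamp t) * quantile x)); last first.
    by apply/funext => u; rewrite /= f_thetaE.
  apply: continuous_cvg; first exact: continuous_expR.
  apply: cvgD; first by apply: cvgN; exact: continuous_clamp.
  apply: cvgM; last exact: cvg_cst.
  apply: continuous_cvg; first exact: sqrt_continuous.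
  by apply: cvgM; [exact: cvg_cst|exact: continuous_clamp].
- by move=> t _; apply: ae_itvoo => x; exact: h1.
- by rewrite inE/= in_itv/=; lra.
Qed.

Lemma continuous_F0_param : continuous (@F0_param R).
Proof.
move=> t; apply/cvg_sup => h.
apply: (@cvg_trans _ (F0_param u @[u --> t])) => //.
move=> A [B [[C oC <-] Ct CA]].
apply: (filterS CA); first exact: fmap_filter.
have H : nbhs (test_integral h (F0_param t)) C by apply: open_nbhs_nbhs; split.
exact: (continuous_test_integral H).
Qed.

Lemma measurable_F0_param : measurable_fun setT (@F0_param R).
Proof.
apply: (measurability (@open (density R))) => //.
move=> _ [U oU <-]; rewrite setTI; apply: open_measurable.
by apply: open_comp => // x _; exact: continuous_F0_param.
Qed.

End F0_param_theory.

Section prior.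
Context {R : realType}.
Local Notation mu := (@lebesgue_measure R).

HB.instance Definition _ := @isMeasurableFun.Build _ _ R
  (density R) (@F0_param R) (@measurable_F0_param R).

Definition theta_weight (t : R) : R := expR (- t^-1) * \1_`[0, 1] t.

Definition theta_mass (A : set R) : \bar R :=
  (\int[mu]_(t in A) (theta_weight t)%:E)%E.

Lemma theta_weight_ge0 t : 0 <= theta_weight t.
Proof. by rewrite mulr_ge0 ?expR_ge0. Qed.

Lemma measurable_theta_weight : measurable_fun setT theta_weight.
Proof.
apply: measurable_funM; last exact: measurable_indic.
apply: measurableT_comp => //; apply: measurableT_comp => //.
have -> : [set: R] = [set 0] `|` ~` [set 0] by rewrite setUv.
apply/measurable_funU => //; first exact: measurableC.
split; first exact: measurable_fun_set1.
apply: open_continuous_measurable_fun; first exact/closed_openC/closed_eq.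
by move=> x /[!inE] /eqP x0; exact: inv_continuous.
Qed.

Let theta_mass0 : theta_mass set0 = 0%E.
Proof. by rewrite /theta_mass integral_set0. Qed.

Let theta_mass_ge0 A : (0 <= theta_mass A)%E.
Proof. by apply: integral_ge0 => t _; rewrite lee_fin theta_weight_ge0. Qed.

Let theta_mass_sigma_additive : semi_sigma_additive theta_mass.
Proof.
apply: (@semi_sigma_additive_nng_induced _ _ R mu (fun t => (theta_weight t)%:E)).
- by apply/measurable_EFinP; exact: measurable_theta_weight.
- by move=> t; rewrite lee_fin theta_weight_ge0.
Qed.

HB.instance Definition _ := isMeasure.Build _ _ _ theta_mass
  theta_mass0 theta_mass_ge0 theta_mass_sigma_additive.

Definition theta_prior := mnormalize theta_mass \d_(0 : R).

Definition Pi_0 : set (density R) -> \bar R := distribution theta_prior F0_param.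

Definition triangle_mass (A : set (density R)) : \bar R :=
  (\sum_(1 <= N <oo) (N%:R ^- 2 : R)%:E *
     \sum_(g \in [set g : density R | F_part N g])
       ('C(2 * N ^ 2, N ^ 2)%:R^-1 : R)%:E * \d_g A)%E.

Lemma dens_inj : injective (@dens R).
Proof.
move=> [f pf] [g pg] /= fg; rewrite /dens/= in fg; subst g.
by congr exist; exact: Prop_irrelevance.
Qed.

Lemma finite_F_part N : finite_set [set g : density R | F_part N g].
Proof.
apply: (@finite_preimage _ _ (F_part N) (@dens R)); first by move=> ? ? _ _; exact: dens_inj.
by apply: finite_image; exact: finite_finset.
Qed.

Let triangle_series : triangle_mass = mseries (fun N : nat =>
  mscale (N%:R ^- 2 : R)%:nng
    (msum (fun k => mscale ('C(2 * N ^ 2, N ^ 2)%:R^-1 : R)%:nng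
      \d_(nth point (fset_set [set g : density R | F_part N g]) k))
    (size (fset_set [set g : density R | F_part N g])))) 1.
Proof.
apply/funext => A; rewrite /triangle_mass /mseries; congr (limn _).
apply/funext => n; apply: eq_bigr => N _; rewrite /mscale/=; congr (_ * _)%E.
rewrite /msum fsbig_finite; last exact: finite_F_part.
by rewrite (big_nth point) big_mkord.
Qed.

Let triangle_mass0 : triangle_mass set0 = 0%E.
Proof. by rewrite triangle_series measure0. Qed.

Let triangle_mass_ge0 A : (0 <= triangle_mass A)%E.
Proof. by rewrite triangle_series. Qed.

Let triangle_mass_sigma_additive : semi_sigma_additive triangle_mass.
Proof. by rewrite triangle_series; exact: measure_semi_sigma_additive. Qed.

HB.instance Definition _ := isMeasure.Build _ _ _ triangle_mass
  triangle_mass0 triangle_mass_ge0 triangle_mass_sigma_additive.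

Definition Pi_triangle : set (density R) -> \bar R :=
  mnormalize triangle_mass \d_(F0_param 0).

Definition prior (A : set (density R)) : \bar R :=
  ((2^-1)%:E * Pi_0 A + (2^-1)%:E * Pi_triangle A)%E.

HB.instance Definition _ := Probability.on Pi_0.
HB.instance Definition _ := Probability.on Pi_triangle.

Let prior_add : prior = measure_add (mscale (2^-1 : R)%:nng Pi_0) (mscale (2^-1 : R)%:nng Pi_triangle).
Proof. by apply/funext => A; rewrite measure_addE. Qed.

Let prior0 : prior set0 = 0%E.
Proof. by rewrite prior_add /measure_add measure0. Qed.

Let prior_ge0 A : (0 <= prior A)%E.
Proof. by rewrite prior_add /measure_add. Qed.

Let prior_sigma_additive : semi_sigma_additive prior.
Proof. by rewrite prior_add /measure_add; exact: measure_semi_sigma_additive. Qed.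

HB.instance Definition _ := isMeasure.Build _ _ _ prior
  prior0 prior_ge0 prior_sigma_additive.

Let prior_setT : prior setT = 1%E.
Proof.
by rewrite /prior !probability_setT !mule1 -EFinD; congr EFin; field.
Qed.

HB.instance Definition _ := Measure_isProbability.Build _ _ _ prior prior_setT.

End prior.

Section posterior.
Context {R : realType}.
Implicit Types (fstar : R -> R) (x : nat -> R) (n : nat).

(* The observations X_1, ..., X_n are x 0, ..., x n.-1. *)
Definition likelihood_ratio fstar x n (f : density R) : R :=
  \prod_(i < n) (f (x i) / fstar (x i)).

Definition posterior fstar x n (A : set (density R)) : \bar R :=
  (\int[prior]_(f in A) (likelihood_ratio fstar x n f)%:E /
   \int[prior]_f (likelihood_ratio fstar x n f)%:E)%E.

Definition law_of_density (f : R -> R) (A : set R) : \bar R :=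
  (\int[lebesgue_measure]_(x in A `&` `[0%R, 1%R[) (f x)%:E)%E.

End posterior.

Section data.
Context d (Omega : measurableType d) (R : realType) (P : probability Omega R).
Implicit Type X : nat -> {RV P >-> R}.

Definition mutually_independent X : Prop :=
  forall (J : {fset nat}) (A : nat -> set R), (forall i, measurable (A i)) ->
    P (\bigcap_(i in [set` J]) (X i @^-1` A i)) =
    (\prod_(i <- J) P (X i @^-1` A i))%E.

Definition iid_from_density X (f : R -> R) : Prop :=
  mutually_independent X /\
  forall i (A : set R), measurable A ->
    distribution P (X i) A = law_of_density f A.

Definition gamma_inconsistent X (fstar : R -> R) (gamma : R) : Prop :=
  {ae P, forall w, limn_esup (fun n =>
     posterior fstar (X ^~ w) n
       [set f | likelihood_ratio fstar (X ^~ w) n f = expR (gamma * n%:R)])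
   = 1%E}.

End data.

(* Main.v *)
Require Import Defs.
From HB Require Import structures.
From mathcomp Require Import all_boot all_order all_algebra finmap.
From mathcomp Require Import all_classical all_reals all_analysis.
From mathcomp Require Import measurable_realfun zify lra ring.
Set Implicit Arguments.
Unset Strict Implicit.
Unset Printing Implicit Defensive.
Import Order.TTheory GRing.Theory Num.Theory.
Import numFieldNormedType.Exports.

(** The posterior mass splits into a smooth part, carried by the densities f_theta,
    and a discrete part, carried by the step functions that are 2 on half of the
    cells of a partition.  The step functions have likelihood ratio 2^n if they
    cover all the data and 0 otherwise, so it suffices that the smooth part is
    negligible against the discrete one for arbitrarily large n.

    The discrete part is polynomially large for every sample.  A random half
    of the 2n^2 cells of partition number n covers n given points with probability
    at least 2^-n / 2 (central_bin_le), because the cells are so many that drawing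
    without replacement hardly differs from independent draws.  The factor 2^-n is
    offset by the likelihood ratio 2^n, and the prior weight of that partition is
    of order 1 / n^2 (Pi_triangle_covering).

    The smooth part is small because the prior on theta vanishes like
    exp(-1 / theta) at the truth.  With S the sum of the normal scores
    Phi^-1(X_i), the integrand is exp(- n theta + sqrt(2 theta) S - 1 / theta).
    If S is at most n^(3/4), then the exponent is at most - sqrt n / 3 for every
    theta (laplace_exponent).  The scores are pairwise independent standard
    normal variables, and by Chebyshev's inequality S exceeds n^(3/4) with
    probability O(1 / sqrt n); hence almost surely S <= n^(3/4) for infinitely
    many n (sum_scores_often_small).  At such n the posterior mass of the
    step functions covering the data is at least 1 - O(1 / sqrt n)
    (posterior_power2_ge), and it never exceeds 1.

    One technical point: the sigma-algebra on the densities is generated by weak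
    convergence, for which point evaluations are not continuous.  Only sets of
    step functions are shown to be measurable, by separating each step function
    from all other densities by test functions (measurable_triangle); the
    likelihood ratio itself is integrated as a possibly nonmeasurable nonnegative
    function, through the simple functions below it. *)

Local Open Scope classical_set_scope.
Local Open Scope ring_scope.

(** * Counting the halves of a partition that cover the data *)

(** Complementation turns the sets containing H into the subsets of the
    complement of H, which are counted by a binomial coefficient. *)
Lemma card_supersets (T : finType) (H : {set T}) (m : nat) : (m <= #|T|)%N ->
  #|[set S : {set T} | (H \subset S) && (#|S| == m)]%SET| =
  'C(#|T| - #|H|, #|T| - m).
Proof.
move=> mT; have -> : (#|T| - #|H| = #|~: H|)%N by have := cardsC H; lia.
rewrite -cards_draws -(card_preimset _ (@finset.setC_inj T)).
apply: eq_card => S; rewrite !finset.in_set -[H in LHS]finset.setCK finset.setCS; congr andb.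
have := cardsC S; lia.
Qed.

(** A set of size M in 2M points contains k given points with probability
    'C(2M - k, M) / 'C(2M, M), the product over i < k of
    (M - i) / (2M - i).  Each factor is at least (1 - i / M) / 2, so the
    probability is at least 2^-k (1 - k^2 / (2M)); the inequality is this bound
    with denominators cleared, and one factor is treated at each step of the
    induction. *)
Lemma central_bin_step (M k : nat) : (k <= M)%N ->
  ('C(2 * M, M) * (2 * M - k ^ 2) <= 2 ^ k * 'C(2 * M - k, M) * (2 * M))%N.
Proof.
elim: k => [|k IH] kM; first by rewrite subn0 expn0 mul1n.
have {}IH := IH (ltnW kM).
have := mul_bin_down (2 * M - k) M.
rewrite -subnS (_ : 2 * M - k - M = M - k)%N; last by lia.
move: IH; set a := 'C(_, M); set b := 'C(_ - k, M); set c := 'C(_ - k.+1, M).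
move=> IH E; rewrite (expnS 2).
have p0 : (0 < 2 * M - k)%N by lia.
rewrite -(leq_pmul2r p0).
have F : ((2 * M - k.+1 ^ 2) * (2 * M - k) <= 2 * (M - k) * (2 * M - k ^ 2))%N.
  have [h|h] := leqP (2 * M)%N (k.+1 ^ 2)%N; first by have -> : (2 * M - k.+1 ^ 2 = 0)%N by lia.
  have h' : (k ^ 2 < k.+1 ^ 2)%N by rewrite ltn_sqr.
  (* The substitution 2M = (k + 1)^2 + r removes all truncated subtractions. *)
  have [r Er] : exists r, (2 * M = k.+1 ^ 2 + r)%N by exists (2 * M - k.+1 ^ 2)%N; lia.
  have e1 : (2 * (M - k) = k ^ 2 + 1 + r)%N by rewrite mulnBr Er; lia.
  have e3 : (2 * M - k = k ^ 2 + k + 1 + r)%N by rewrite Er; lia.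
  have e4 : (2 * M - k ^ 2 = 2 * k + 1 + r)%N by rewrite Er; lia.
  by rewrite e1 e3 e4 Er addKn [leqRHS](_ : _ = r * (k ^ 2 + k + 1 + r) +
      (r * (k + 1) + (k ^ 2 + 1) * (2 * k + 1)))%N ?leq_addr//; ring.
have -> : (2 * 2 ^ k * c * (2 * M) * (2 * M - k) = 2 * (M - k) * (2 ^ k * b * (2 * M)))%N.
  by transitivity (2 * 2 ^ k * (2 * M) * ((2 * M - k) * c))%N; [ring|rewrite E; ring].
rewrite -mulnA; apply: (leq_trans (leq_mul (leqnn _) F)).
rewrite mulnCA leq_mul2l IH orbT //.
Qed.

(** With M = n^2 the correction k^2 / (2M) is at most one half, so that a random
    half of the cells covers n data points with probability at least
    2^-n / 2: almost as often as if the cells were chosen independently. *)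
Lemma central_bin_le (n k : nat) : (k <= n)%N ->
  ('C(2 * n ^ 2, n ^ 2) <= 2 * (2 ^ n * 'C(2 * n ^ 2 - k, n ^ 2)))%N.
Proof.
move=> kn; case: (posnP n) kn => [->|n0] kn.
  by move: kn; rewrite leqn0 => /eqP ->.
have kM : (k <= n ^ 2)%N by rewrite (leq_trans kn)// -{1}(expn1 n) leq_pexp2l.
have := central_bin_step kM.
have kk : (k ^ 2 <= n ^ 2)%N by rewrite leq_sqr.
have nn : (0 < n ^ 2)%N by rewrite expn_gt0 n0.
have e2 : (2 ^ k <= 2 ^ n)%N by rewrite leq_exp2l.
move: nn kk e2; set M := (n ^ 2)%N; set a := 'C(_, M); set b := 'C(_ - k, M) => nn kk e2 h.
rewrite -(leq_pmul2r nn).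
apply: (@leq_trans (a * (2 * M - k ^ 2))%N); first by rewrite leq_mul2l; lia.
apply: (leq_trans h).
have -> : (2 ^ k * b * (2 * M) = 2 ^ k * (2 * b * M))%N by ring.
have -> : (2 * (2 ^ n * b) * M = 2 ^ n * (2 * b * M))%N by ring.
by rewrite leq_mul2r e2 orbT.
Qed.

(** * Cells and the densities constant on them *)

Section cells.
Context {R : realType}.
Implicit Types (N j : nat) (x : R).

Lemma cellE N j x : (0 < N)%N -> 0 <= x ->
  cell N j x <-> Num.truncn (x * (2 * N ^ 2)%:R) = j.
Proof.
move=> N0 x0.
have c0 : 0 < (2 * N ^ 2)%:R :> R by rewrite ltr0n muln_gt0 expn_gt0 N0.
rewrite /cell /= in_itv/= ler_pdivrMr// ltr_pdivlMr// -truncn_eq ?mulr_ge0 ?ler0n//.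
by split => [/eqP|->].
Qed.

Lemma cell_ge0 N j x : cell N j x -> 0 <= x.
Proof. by rewrite /cell/= in_itv/= => /andP[+ _]; apply: le_trans; rewrite divr_ge0 ?ler0n. Qed.

Lemma ex_cell N x : (0 < N)%N -> x \in `[0, 1[ ->
  exists j : 'I_(2 * N ^ 2), cell N j x.
Proof.
rewrite in_itv/= => N0 /andP[x0 x1].
have c0 : 0 < (2 * N ^ 2)%:R :> R by rewrite ltr0n muln_gt0 expn_gt0 N0.
have h : (Num.truncn (x * (2 * N ^ 2)%:R) < 2 * N ^ 2)%N.
  rewrite -(ltr_nat R); apply: (@le_lt_trans _ _ (x * (2 * N ^ 2)%:R)).
    by have /andP[] := truncn_itv (mulr_ge0 x0 (ltW c0)).
  by rewrite gtr_pMl.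
by exists (Ordinal h); apply/cellE.
Qed.

(** Since the cells of one partition are disjoint, the value at a point depends
    only on the cell that contains it. *)
Lemma two_onE N (S : {set 'I_(2 * N ^ 2)}) (j : 'I_(2 * N ^ 2)) x :
  (0 < N)%N -> cell N j x -> two_on S x = if j \in S then 2 else 0.
Proof.
move=> N0 jx; rewrite /two_on indicE.
case: ifPn => jS.
  by rewrite mem_set ?mulr1//; exists j.
rewrite memNset ?mulr0// => -[k /= kS kx].
suff e : k = j by move: jS; rewrite -e kS.
have x0 := cell_ge0 jx.
by apply/val_inj; move/(cellE _ N0 x0) : jx => /= <-; move/(cellE _ N0 x0) : kx.
Qed.

Lemma cell_left N j : (0 < N)%N -> cell N j (j%:R / (2 * N ^ 2)%:R : R).
Proof.
move=> N0.
have c0 : 0 < (2 * N ^ 2)%:R :> R by rewrite ltr0n muln_gt0 expn_gt0 N0.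
by rewrite /cell/= in_itv/= lexx ltr_pM2r ?invr_gt0// ltr_nat ltnSn.
Qed.

Lemma two_on_inj N : (0 < N)%N -> injective (@two_on R N).
Proof.
move=> N0 S S' SS'; apply/setP => j.
have := congr1 (fun f => f (j%:R / (2 * N ^ 2)%:R)) SS'; rewrite /=.
rewrite !(two_onE _ N0 (cell_left j N0)).
by case: (j \in S); case: (j \in S') => // /eqP; rewrite ?(eq_sym 0) pnatr_eq0.
Qed.

Lemma two_on_ge0 N (S : {set 'I_(2 * N ^ 2)}) x : 0 <= two_on S x.
Proof. by rewrite /two_on mulr_ge0. Qed.

Lemma F_part_two_on N (S : {set 'I_(2 * N ^ 2)}) :
  #|S| = (N ^ 2)%N -> F_part N (@two_on R N S).
Proof. by move=> cS; exists S. Qed.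

Lemma F_triangle_two_on N (S : {set 'I_(2 * N ^ 2)}) : (0 < N)%N ->
  #|S| = (N ^ 2)%N -> (F_zero `|` F_triangle) (@two_on R N S).
Proof. by move=> N0 cS; right; exists N => //; exact: F_part_two_on. Qed.

(** Distinct sets of cells give distinct densities, so a sum over the densities
    of F_part N is a count of sets of cells. *)
Lemma sum_F_part_dirac N (Q : set (R -> R)) : (0 < N)%N ->
  (\sum_(g \in [set g : density R | F_part N g])
      ('C(2 * N ^ 2, N ^ 2)%:R^-1 : R)%:E * \d_g [set f : density R | Q f])%E =
  (#|[set S : {set 'I_(2 * N ^ 2)} | (#|S| == N ^ 2)%N && `[<Q (two_on S)>]]%SET|%:R
   / 'C(2 * N ^ 2, N ^ 2)%:R : R)%:E.
Proof.
move=> N0.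
pose h (S : {set 'I_(2 * N ^ 2)}) : density R :=
  if pselect ((F_zero `|` F_triangle) (@two_on R N S)) is left p
  then exist _ _ p else point.
have hE (S : {set 'I_(2 * N ^ 2)}) : #|S| = (N ^ 2)%N -> h S = two_on S :> (R -> R).
  by move=> cS; rewrite /h; case: pselect => // -[]; exact: F_triangle_two_on.
rewrite (reindex_fsbig h [set` [pred S : {set 'I_(2 * N ^ 2)} | #|S| == (N ^ 2)%N]]); last first.
  split => [S /eqP cS /=|S S' /[!inE] /eqP cS /eqP cS' e|g [S /= cS e]].
  - by rewrite hE//; exact: F_part_two_on.
  - by apply: (two_on_inj N0); rewrite -!hE// e.
  - by exists S => /=; [exact/eqP|apply/dens_inj; rewrite hE].
rewrite -(@bigfs _ _ _ _ (index_enum _)) ?index_enum_uniq//; last first.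
  by move=> S _; rewrite mem_index_enum.
rewrite (eq_bigr (fun S => ('C(2 * N ^ 2, N ^ 2)%:R^-1 * `[<Q (two_on S)>]%:R : R)%:E)); last first.
  move=> S /eqP cS; rewrite diracE EFinM; congr (_ * (nat_of_bool _)%:R%:E)%E.
  by apply/idP/asboolP; rewrite inE/= hE.
rewrite sumEFin -mulr_sumr mulrC; congr ((_ * _)%:E).
rewrite -natr_sum; congr (_%:R).
rewrite -big_mkcondr sum1dep_card; apply: eq_card => S.
by rewrite !finset.in_set.
Qed.

End cells.

(** * The discrete part of the prior *)

Section triangle_prior.
Context {R : realType}.
Implicit Types (N n : nat) (x : nat -> R).

(** The probability that the density of a uniformly random half of the 2N^2 cells
    satisfies Q. *)
Definition cell_fraction N (Q : set (R -> R)) : R :=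
  #|[set S : {set 'I_(2 * N ^ 2)} |
      (#|S| == N ^ 2)%N && `[<Q (two_on S)>]]%SET|%:R / 'C(2 * N ^ 2, N ^ 2)%:R.

Lemma cell_fraction_ge0 N Q : 0 <= cell_fraction N Q.
Proof. by rewrite divr_ge0. Qed.

Lemma triangle_massE (Q : set (R -> R)) :
  triangle_mass [set f : density R | Q f] =
  (\sum_(1 <= N <oo) (N%:R ^- 2 * cell_fraction N Q)%:E)%E.
Proof.
rewrite /triangle_mass; congr (limn _); apply/funext => n.
rewrite !big_nat; apply: eq_bigr => N /andP[N0 _].
by rewrite sum_F_part_dirac// -EFinM.
Qed.

Lemma triangle_mass_ge N (Q : set (R -> R)) : (0 < N)%N ->
  ((N%:R ^- 2 * cell_fraction N Q)%:E <= triangle_mass [set f : density R | Q f])%E.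
Proof.
move=> N0; rewrite triangle_massE.
apply: le_trans; last apply: (nneseries_lim_ge N.+1).
  rewrite big_nat_recr//= leeDr// sume_ge0// => k _.
  by rewrite lee_fin mulr_ge0 ?cell_fraction_ge0// invr_ge0 exprn_ge0.
by move=> k _ _; rewrite lee_fin mulr_ge0 ?cell_fraction_ge0// invr_ge0 exprn_ge0.
Qed.

Lemma cell_fractionT N : cell_fraction N setT = 1.
Proof.
rewrite /cell_fraction (_ : #|_| = 'C(2 * N ^ 2, N ^ 2)).
  by rewrite divff// pnatr_eq0 -lt0n bin_gt0; lia.
rewrite -[in RHS](card_ord (2 * N ^ 2)) -card_draws; apply: eq_card => S.
by rewrite !finset.in_set asboolT ?andbT.
Qed.

(** Telescoping: 1 / (n + 1)^2 is at most 1 / n - 1 / (n + 1).  The value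
    n = 0 is covered by the convention that the inverse of 0 is 0. *)
Lemma sum_inv_sqr_le2 n : \sum_(1 <= N < n.+1) (N%:R ^- 2 : R) <= 2 - n%:R^-1.
Proof.
elim: n => [|n IH]; first by rewrite big_geq// invr0 subr0.
rewrite big_nat_recr//=; case: n IH => [_|n IH].
  by rewrite big_geq// add0r expr1n invr1; lra.
have a0 : 0 < n.+1%:R :> R by [].
suff h : n.+2%:R ^- 2 <= n.+1%:R^-1 - n.+2%:R^-1 :> R.
  by apply: (le_trans (lerD IH h)); rewrite addrA subrK.
rewrite -[n.+2]addn1 natrD; move: a0; move: (n.+1%:R) => a a0.
rewrite (_ : a^-1 - (a + 1)^-1 = (a * (a + 1))^-1); last first.
  by field; apply/andP; split; lra.
by rewrite lef_pV2 ?posrE ?mulr_gt0 ?exprn_gt0// ?expr2 ?ler_wpM2r//; lra.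
Qed.

Lemma triangle_massT_le2 : (@triangle_mass R setT <= 2%:E)%E.
Proof.
rewrite (_ : setT = [set f : density R | setT (f : R -> R)]); last first.
  by apply/seteqP; split.
rewrite triangle_massE; apply: lime_le.
  apply: is_cvg_nneseries => N _ _.
  by rewrite lee_fin mulr_ge0 ?cell_fraction_ge0// invr_ge0 exprn_ge0.
apply: nearW => -[|n]; first by rewrite big_geq// lee_fin.
rewrite (eq_bigr (fun N => (N%:R ^- 2 : R)%:E)) => [|N _]; last by rewrite cell_fractionT mulr1.
rewrite sumEFin lee_fin (le_trans (sum_inv_sqr_le2 n))//.
by rewrite lerBlDr lerDl invr_ge0.
Qed.

Lemma triangle_massT_gt0 : (0 < @triangle_mass R setT)%E.
Proof.
apply: (@lt_le_trans _ _ 1%E) => //.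
have := @triangle_mass_ge 1%N setT isT.
rewrite cell_fractionT expr1n invr1 mulr1.
by rewrite (_ : [set f : density R | setT (f : R -> R)] = setT)//; apply/seteqP; split.
Qed.

Lemma Pi_triangleE (A : set (density R)) :
  Pi_triangle A = (triangle_mass A * (fine (@triangle_mass R setT))^-1%:E)%E.
Proof.
rewrite /Pi_triangle /mnormalize ifF//.
rewrite gt_eqF ?triangle_massT_gt0//=; apply/negbTE.
by rewrite lt_eqF// (le_lt_trans triangle_massT_le2)// ltry.
Qed.

Lemma Pi_triangle_ge (A : set (density R)) :
  (triangle_mass A * (2^-1)%:E <= Pi_triangle A)%E.
Proof.
have f2 := triangle_massT_le2; have f0 := triangle_massT_gt0.
have ffin : @triangle_mass R setT \is a fin_num.
  by rewrite ge0_fin_numE ?(le_lt_trans f2 (ltry _))// ltW.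
rewrite Pi_triangleE lee_wpmul2l// lee_fin lef_pV2 ?posrE//.
  by rewrite -lee_fin fineK.
by rewrite -lte_fin fineK.
Qed.

(** Lets a property of the discrete densities be used almost surely for the
    discrete part of the prior. *)
Lemma Pi_triangleC0 : Pi_triangle [set f : density R | ~ F_triangle f] = 0%E.
Proof.
rewrite Pi_triangleE (triangle_massE [set f | ~ F_triangle f]).
rewrite eseries0 ?mul0e// => N N1 _; congr EFin.
rewrite /cell_fraction (_ : #|_| = 0%N) ?mul0r ?mulr0//.
apply: eq_card0 => S; rewrite !finset.in_set; apply/negP => /andP[/eqP cS /asboolP].
by apply; exists N => //; exact: F_part_two_on.
Qed.

(** A density of F_part n equals 2 at all the data points exactly when its set of
    cells contains the at most n cells hit by them.  The bound does not depend
    on the position of the points. *)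
Lemma cell_fraction_covering n x : (forall i, x i \in `[0, 1[) ->
  2 ^- n / 2 <= cell_fraction n [set f | forall i : 'I_n, f (x i) = 2].
Proof.
move=> x01; case: (posnP n) => [->|n0].
  rewrite (_ : [set _ | _] = setT); last by apply/seteqP; split => // f _ [i i0]; exfalso; move: i0; rewrite ltn0.
  by rewrite cell_fractionT expr0 invr1 mul1r invf_le1 ?ler1n.
have /choice[c cx] i : exists j : 'I_(2 * n ^ 2), cell n j (x i).
  by apply: ex_cell.
set Q := [set f | _].
pose H : {set 'I_(2 * n ^ 2)} := [set c (i : 'I_n) | i : 'I_n]%SET.
have Hn : (#|H| <= n)%N by rewrite (leq_trans (leq_imset_card _ _))// card_ord.
have H2 : (#|[set S : {set 'I_(2 * n ^ 2)} | (#|S| == n ^ 2)%N &&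
    `[<Q (two_on S)>]]%SET|
   = 'C(2 * n ^ 2 - #|H|, n ^ 2))%N.
  have := @card_supersets _ H (n ^ 2); rewrite card_ord.
  rewrite (_ : 2 * n ^ 2 - n ^ 2 = n ^ 2)%N; last by lia.
  move=> <-; last by lia.
  apply: eq_card => S; rewrite !finset.in_set andbC; congr andb.
  apply/asboolP/fintype.subsetP => /= [h j /imsetP[i _ ->]|h i].
    have := h i; rewrite (two_onE _ n0 (cx i)); case: ifP => // _ /eqP.
    by rewrite eq_sym pnatr_eq0.
  by rewrite (two_onE _ n0 (cx i)) h// imset_f.
rewrite /cell_fraction H2 ler_pdivlMr; last by rewrite ltr0n bin_gt0; lia.
rewrite -invfM mulrC ler_pdivrMr ?mulr_gt0 ?exprn_gt0//.
rewrite -natrX -!natrM ler_nat.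
by apply: (leq_trans (central_bin_le Hn)); apply/eq_leq; ring.
Qed.

(** Partition number n alone, of prior weight proportional to 1 / n^2, gives the
    likelihood-maximising densities a mass of order 2^-n / n^2. *)
Lemma Pi_triangle_covering n x : (0 < n)%N -> (forall i, x i \in `[0, 1[) ->
  ((2 ^- n / (4 * n%:R ^+ 2))%:E <= Pi_triangle
    [set f : density R | F_triangle f /\ forall i : 'I_n, f (x i) = 2%R])%E.
Proof.
move=> n0 x01; apply: le_trans (Pi_triangle_ge _).
set A := [set f : density R | _]; rewrite -lee_pdivrMr//.
set Q := [set f : R -> R | F_triangle f /\ forall i : 'I_n, f (x i) = 2%R].
apply: le_trans (@triangle_mass_ge n Q n0).
rewrite -EFinM lee_fin (_ : _ / _ / 2^-1 = n%:R ^- 2 * (2 ^- n / 2)); last first.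
  by field; rewrite pnatr_eq0 -lt0n n0 expf_neq0.
apply: ler_wpM2l; first by rewrite invr_ge0 exprn_ge0.
apply: (le_trans (cell_fraction_covering n x01)).
rewrite ler_pM2r ?invr_gt0 ?ltr0n ?bin_gt0; last by lia.
rewrite ler_nat; apply/subset_leq_card/fintype.subsetP => S.
rewrite !finset.in_set => /andP[/eqP cS /asboolP h]; rewrite cS eqxx/=.
by apply/asboolP; split => //; exists n => //; exact: F_part_two_on.
Qed.

End triangle_prior.

(** * Separation of discrete densities by weak convergence *)

Section weak_separation.
Context {R : realType}.
Local Notation mu := (@lebesgue_measure R).
Implicit Types (a b x : R) (f g : density R).

Lemma continuous_test_integral_density (h : {h : R -> R | bounded_continuous h}) :
  continuous (test_integral h).
Proof.
move=> f; have cf : nbhs f --> f by [].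
move/cvg_sup : cf => /(_ h) cf.
by move=> A /(@initial_continuous _ _ (test_integral h) f); exact: cf.
Qed.

(** A continuous function that is positive exactly on the interval ]a, b[ serves
    as a test function detecting whether a density vanishes there. *)
Definition bump a b x : R := Num.max 0 ((x - a) * (b - x)).

Lemma bump_gt0 a b x : x \in `]a, b[ -> 0 < bump a b x.
Proof.
by rewrite in_itv/= => /andP[ax xb]; rewrite /bump lt_max mulr_gt0 ?orbT// subr_gt0.
Qed.

Lemma bump_eq0 a b x : x \notin `]a, b[ -> a < b -> bump a b x = 0.
Proof.
rewrite in_itv/= negb_and -!leNgt => /orP[xa|bx] ab; apply/max_idPl.
  by rewrite mulr_le0_ge0// ?subr_le0// subr_ge0; lra.
by rewrite mulr_ge0_le0// ?subr_le0// subr_ge0; lra.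
Qed.

Lemma continuous_bump a b : continuous (bump a b).
Proof.
move=> x; apply: (@continuous_max R R (cst 0) (fun t => (t - a) * (b - t))).
  exact: cvg_cst.
apply: cvgM; first by apply: cvgB; [exact: cvg_id|exact: cvg_cst].
by apply: cvgB; [exact: cvg_cst|exact: cvg_id].
Qed.

Lemma bump_bounded a b x : 0 <= a -> a < b -> b <= 1 -> `|bump a b x| <= 1.
Proof.
move=> a0 ab b1; have [xab|xab] := boolP (x \in `]a, b[); last first.
  by rewrite bump_eq0// normr0.
rewrite ger0_norm /bump ?le_max ?lexx// ge_max ler01/=.
by move: xab; rewrite in_itv/= => /andP[ax xb]; rewrite mulr_ile1//; lra.
Qed.

Lemma bounded_continuous_bump a b : 0 <= a -> a < b -> b <= 1 -> bounded_continuous (bump a b).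
Proof.
move=> a0 ab b1; split; last by exists 1 => x _; exact: bump_bounded.
by apply: continuous_subspaceT; exact: continuous_bump.
Qed.

Lemma measurable_two_on N (S : {set 'I_(2 * N ^ 2)}) : measurable_fun setT (@two_on R N S).
Proof.
apply: measurable_funM => //; apply: measurable_indic.
apply: fin_bigcup_measurable; first exact: finite_finset.
by move=> j _; exact: measurable_itv.
Qed.

Lemma density_ge0 f x : 0 <= f x.
Proof.
case: f => f /= [[t _ <-]|[N _ [S _ <-]]]; last exact: two_on_ge0.
by rewrite /f_theta; case: ifP => // _; rewrite fine_ge0// expeR_ge0.
Qed.

(** Without integrability a test integral would be the default value 0 of a
    divergent integral, and could not detect positivity. *)
Lemma integrable_density f : mu.-integrable `[0, 1[ (EFin \o f).
Proof.
case: f => f /= [[t t01 <-]|[N _ [S _ <-]]]; last first.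
  apply: measurable_bounded_integrable => //.
  - by rewrite /= lebesgue_measure_itv/= lte_fin ltr01 -EFinB ltry.
  - by apply: measurable_funTS; exact: measurable_two_on.
  - exists 2; split => // M M2 x _ /=.
    rewrite ger0_norm ?two_on_ge0// (le_trans _ (ltW M2))//.
    by rewrite /two_on indicE; case: (_ \in _) => /=; lra.
have ct : clamp t = t.
  move: t01; rewrite /= in_itv/= /clamp => /andP[t0 t1].
  by rewrite (min_idPl t1) (max_idPr t0).
have mf := measurable_f_theta t.
have sub : (`]0, 1[%classic : set R) `<=` `[0, 1[%classic.
  by move=> x; rewrite /= !in_itv/= => /andP[/ltW -> ->].
apply/integrableP; split; first exact/measurable_EFinP.
rewrite -integral_itv_obnd_cbnd; last first.
  by apply: measurableT_comp => //; apply/measurable_EFinP; exact: measurable_funS mf.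
have ig : mu.-integrable `]0, 1[ (fun x => (1 + expR (Num.sqrt 2 * quantile x))%:E).
  apply: (@integrableD _ _ _ mu _ _ (cst 1%E) (fun x => (expR (Num.sqrt 2 * quantile x))%:E)) => //.
    apply: (@measurable_bounded_integrable _ _ _ mu (cst 1)) => //.
    - by rewrite /= lebesgue_measure_itv/= lte_fin ltr01 -EFinB ltry.
    - exists 1; split => // M M1 x _ /=; rewrite normr1; exact: ltW.
  exact: integrable_exp_qu.
have : mu.-integrable `]0, 1[ (EFin \o f_theta t).
  apply: le_integrable ig => //.
  - by apply/measurable_EFinP; exact: measurable_funS mf.
  - move=> x x01 /=; rewrite lee_fin (le_trans _ (ler_norm _))// -ct.
    exact: f_theta_bound.
by move/integrableP => -[].
Qed.

Lemma test_integral_separates f g a b : 0 <= a -> a < b -> b <= 1 ->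
  (forall x, x \in `]a, b[ -> 0 < f x) -> (forall x, x \in `]a, b[ -> g x = 0) ->
  exists h, test_integral h f != test_integral h g.
Proof.
move=> a0 ab b1 fpos g0.
exists (exist _ _ (bounded_continuous_bump a0 ab b1)); rewrite /test_integral/=.
rewrite [X in _ != X](_ : _ = 0); last first.
  rewrite /Rintegral integral0_eq// => x _; congr EFin.
  have [xab|xab] := boolP (x \in `]a, b[); first by rewrite g0// mulr0.
  by rewrite bump_eq0// mul0r.
have mb : measurable_fun (`[0, 1[ : set R) (bump a b).
  by apply: measurable_funTS; apply: continuous_measurable_fun; exact: continuous_bump.
have mf : measurable_fun (`[0, 1[ : set R) f.
  by apply/measurable_EFinP; exact: (measurable_int mu (integrable_density f)).
have ip : mu.-integrable `[0, 1[ (fun x => (bump a b x * f x)%:E).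
  apply: le_integrable (integrable_density f) => //.
    by apply/measurable_EFinP; exact: measurable_funM.
  move=> x x01; rewrite lee_fin normrM ler_piMl//; exact: bump_bounded.
apply/eqP => r0.
have i0 : (\int[mu]_(x in `[0%R, 1%R[) (bump a b x * f x)%:E = 0)%E.
  by rewrite -[RHS](congr1 EFin r0) /Rintegral fineK//; exact: integrable_fin_num.
have : (\int[mu]_(x in `[0%R, 1%R[) `|(bump a b x * f x)%:E| = 0)%E.
  rewrite -[RHS]i0; apply: eq_integral => x _; rewrite gee0_abs// lee_fin.
  by rewrite mulr_ge0 ?density_ge0// /bump le_max lexx.
move/ae_eq_integral_abs => /(_ _ (measurable_int mu ip)).
move=> /(_ (measurable_itv _))[A [mA A0 sA]].
have : (mu `]a, b[ <= mu A)%E.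
  apply: le_measure; rewrite ?inE// => x xab; apply: sA => /=.
  move=> /(_ _)/wrap[]; first by move: xab; rewrite /= !in_itv/=; lra.
  by move=> [] /eqP; rewrite mulf_eq0 !gt_eqF ?bump_gt0 ?fpos.
rewrite A0 lebesgue_measure_itv/= lte_fin ab -EFinB lee_fin; lra.
Qed.

(** Step functions are constant to the right of every point; if two of them differ
    at x, then they differ on an interval starting at x, and there one of them
    is 2 and the other 0. *)
Lemma two_on_neq_cell N (S : {set 'I_(2 * N ^ 2)}) N' (S' : {set 'I_(2 * N' ^ 2)}) :
  (0 < N)%N -> (0 < N')%N -> @two_on R N S <> two_on S' ->
  exists x b, [/\ 0 <= x, x < b, b <= 1 &
   ((forall y, y \in `]x, b[ -> 0 < two_on S y) /\ (forall y, y \in `]x, b[ -> two_on S' y = 0)) \/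
   ((forall y, y \in `]x, b[ -> 0 < two_on S' y) /\ (forall y, y \in `]x, b[ -> two_on S y = 0))].
Proof.
move=> N0 N'0 SS'.
have [x fx] : exists x, @two_on R N S x <> two_on S' x.
  by apply: contrapT => h; apply: SS'; apply/funext => x; apply: contrapT => hx; apply: h; exists x.
have out M (U : {set 'I_(2 * M ^ 2)}) : (0 < M)%N -> x \notin `[0, 1[ -> @two_on R M U x = 0.
  move=> M0 x01; rewrite /two_on indicE memNset ?mulr0// => -[j _] jx; apply/negP : x01.
  rewrite negbK; move: (jx); rewrite /cell/= !in_itv/= (cell_ge0 jx)/= => /andP[_].
  move/lt_le_trans; apply; rewrite ler_pdivrMr ?mul1r ?ler_nat ?ltn_ord//.
  by rewrite ltr0n muln_gt0 expn_gt0 M0.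
have [x01|x01] := boolP (x \in `[0, 1[); last by exfalso; apply: fx; rewrite !out.
have [j jx] := ex_cell N0 x01; have [k kx] := ex_cell N'0 x01.
pose b : R := Num.min (j.+1%:R / (2 * N ^ 2)%:R) (k.+1%:R / (2 * N' ^ 2)%:R).
have xb : x < b.
  by move: jx kx; rewrite /cell/= !in_itv/= lt_min => /andP[_ ->] /andP[_ ->].
have b1 : b <= 1.
  rewrite /b ge_min ler_pdivrMr ?mul1r ?ler_nat ?ltn_ord//.
  by rewrite ltr0n muln_gt0 expn_gt0 N0.
have jy y : y \in `]x, b[ -> cell N j y /\ cell N' k y.
  move: jx kx; rewrite /cell/= !in_itv/= lt_min => /andP[jx _] /andP[kx _] /andP[xy /andP[yj yk]].
  by rewrite yj yk !andbT !(le_trans _ (ltW xy)).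
exists x, b; split => //; first exact: cell_ge0 jx.
move: fx; rewrite (two_onE _ N0 jx) (two_onE _ N'0 kx).
case: ifPn => jS; case: ifPn => kS // _; [left|right]; split => y /jy[jjy kky].
- by rewrite (two_onE _ N0 jjy) jS.
- by rewrite (two_onE _ N'0 kky) (negbTE kS).
- by rewrite (two_onE _ N'0 kky) kS.
- by rewrite (two_onE _ N0 jjy) (negbTE jS).
Qed.

(** A density f_theta is positive on ]0, 1[, whereas a discrete density vanishes on
    some cell; two discrete densities are handled by the previous lemma. *)
Lemma triangle_separated f g : F_triangle g -> f <> g ->
  exists h, test_integral h f != test_integral h g.
Proof.
case=> N N0 [S cS gS] fg.
have [[t _ tf]|[N' N'0 [S' cS' fS']]] := svalP f; last first.
  have : @two_on R N S <> two_on S'.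
    move=> SS'; apply: fg; apply/dens_inj; rewrite [LHS]/dens -fS' -SS'; exact: gS.
  move=> /(two_on_neq_cell N0 N'0)[x [b [x0 xb b1 [[h1 h2]|[h1 h2]]]]].
    have [||h hh] := @test_integral_separates g f x b x0 xb b1.
    - by move=> y yx; rewrite -gS h1.
    - by move=> y yx; rewrite /dens -fS' h2.
    - by exists h; rewrite eq_sym.
  apply: (@test_integral_separates f g x b x0 xb b1).
  - by move=> y yx; rewrite /dens -fS' h1.
  - by move=> y yx; rewrite -gS h2.
have [j jS] : exists j, j \notin S.
  apply: contrapT => h; have : #|S| = #|'I_(2 * N ^ 2)|.
    by apply: eq_card => j; rewrite !inE; apply: contrapT => /negP jS; apply: h; exists j.
  rewrite cS card_ord => /eqP; apply/negP.
  by have : (0 < N ^ 2)%N; [rewrite expn_gt0 N0|lia].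
have c0 : 0 < (2 * N ^ 2)%:R :> R by rewrite ltr0n muln_gt0 expn_gt0 N0.
have a0 : 0 <= j%:R / (2 * N ^ 2)%:R :> R by rewrite divr_ge0.
have b1 : j.+1%:R / (2 * N ^ 2)%:R <= 1 :> R.
  by rewrite ler_pdivrMr ?mul1r ?ler_nat ?ltn_ord.
apply: (@test_integral_separates f g (j%:R / (2 * N ^ 2)%:R) (j.+1%:R / (2 * N ^ 2)%:R)) => //.
- by rewrite ltr_pM2r ?invr_gt0// ltr_nat.
- move=> x; rewrite in_itv/= => /andP[ax xb]; rewrite /dens -tf f_thetaE ?expR_gt0//.
  by rewrite in_itv/= (le_lt_trans a0 ax) (lt_le_trans xb b1).
- move=> x; rewrite in_itv/= => /andP[ax xb]; rewrite -gS (@two_onE _ _ _ j) ?(negbTE jS)//.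
  by rewrite /cell/= in_itv/= (ltW ax).
Qed.

(** The singleton is the intersection of the closed sets on which a test integral
    takes its value at g, because test integrals separate g from every other
    density. *)
Lemma measurable_triangle1 g : F_triangle g -> measurable [set g].
Proof.
move=> Tg.
have -> : [set g] = ~` (~` \bigcap_h [set f | test_integral h f = test_integral h g]).
  rewrite setCK; apply/seteqP; split => [f -> //|f /= hf].
  apply: contrapT => /(triangle_separated Tg)[h /eqP]; apply.
  exact: hf.
apply: measurableC; apply: sub_sigma_algebra; apply: closed_openC.
apply: closed_bigI => h _; apply: (@closed_comp _ _ (test_integral h) [set x | x = test_integral h g]).
  by move=> f _; exact: continuous_test_integral_density.
exact: closed_eq.
Qed.

(** Every set of discrete densities is a countable union of singletons. *)
Lemma measurable_triangle (A : set (density R)) : A `<=` F_triangle \o @dens R -> measurable A.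
Proof.
move=> AT.
have -> : A = \bigcup_N \bigcup_(g in A `&` [set g : density R | (0 < N)%N /\ F_part N g]) [set g].
  apply/seteqP; split => [f Af|f [N _ [g [Ag _]] ->]//].
  have [N N0 NF] := AT f Af; exists N => //; exists f => //.
apply: bigcup_measurable => N _; apply: fin_bigcup_measurable.
  by apply: finite_setIr; apply: sub_finite_set (finite_F_part N) => g [].
by move=> g [_ [N0 Ng]]; apply: measurable_triangle1; exists N.
Qed.

End weak_separation.

(** * Integrals of functions that need not be measurable *)

Import HBNNSimple.

(** For a nonnegative function the integral is the supremum of the integrals of
    the simple functions below it, measurable or not.  It is monotone for that
    reason, and bounds from above only have to be checked on simple functions.
    This matters because evaluation at a point is not shown to be a Borel
    function of the density. *)
Section lower_integral.
Context d (T : measurableType d) (R : realType) (mu : {measure set T -> \bar R}).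
Local Open Scope ereal_scope.

Lemma ge0_integral_le_nnsfun (f : T -> \bar R) (M : \bar R) :
  (forall x, 0 <= f x) ->
  (forall h : {nnsfun T >-> R}, (forall x, (h x)%:E <= f x) ->
     \int[mu]_x (h x)%:E <= M) ->
  \int[mu]_x f x <= M.
Proof.
move=> f0 hM; rewrite ge0_integralTE//; apply: ge_ereal_sup => _ [h hf <-].
by rewrite -integralT_nnsfun; exact: hM.
Qed.

Lemma nnsfun_le_integral (f : T -> \bar R) (h : {nnsfun T >-> R}) :
  (forall x, (h x)%:E <= f x) -> \int[mu]_x (h x)%:E <= \int[mu]_x f x.
Proof.
move=> hf; rewrite [leRHS]ge0_integralTE//; last first.
  by move=> x; apply: le_trans (hf x); rewrite lee_fin.
by rewrite integralT_nnsfun; apply: ereal_sup_ubound; exists h.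
Qed.

Lemma ge0_le_lower_integral (f g : T -> \bar R) :
  (forall x, 0 <= f x) -> (forall x, f x <= g x) ->
  \int[mu]_x f x <= \int[mu]_x g x.
Proof.
move=> f0 fg; apply: ge0_integral_le_nnsfun => // h hf.
by apply: nnsfun_le_integral => x; exact: le_trans (fg x).
Qed.

Lemma indic_le_lower_integral (f : T -> \bar R) (A : set T) (c : R) :
  measurable A -> (0 <= c)%R -> (forall x, 0 <= f x) -> (forall x, A x -> c%:E <= f x) ->
  c%:E * mu A <= \int[mu]_x f x.
Proof.
move=> mA c0 f0 fA.
have -> : c%:E * mu A = \int[mu]_x (c%:E * (\1_A x)%:E).
  rewrite ge0_integralZl_EFin//; first by rewrite integral_indic// setIT.
  by apply/measurable_EFinP; exact: measurable_indic.
apply: ge0_le_lower_integral => x; first by rewrite mule_ge0// lee_fin.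
rewrite indicE; have [/set_mem Ax|_] := boolP (x \in A); first by rewrite mule1 fA.
by rewrite mule0.
Qed.

End lower_integral.

(** * The smooth part of the prior *)

Section theta_integrals.
Context {R : realType}.
Local Notation mu := (@lebesgue_measure R).
Local Open Scope ereal_scope.

(** The measure theta_mass has density theta_weight with respect to Lebesgue
    measure: a simple function is integrated level set by level set. *)
Lemma nnsfun_theta_mass (h : {nnsfun R >-> R}) :
  \int[@theta_mass R]_t (h t)%:E = \int[mu]_t ((h t)%:E * (theta_weight t)%:E).
Proof.
rewrite integralT_nnsfun sintegralE.
have mw := @measurable_theta_weight R.
have mi y : measurable_fun setT (\1_(h @^-1` [set y]) : R -> R).
  by apply: measurable_indic; exact: measurable_sfunP.
transitivity (\int[mu]_t \sum_(y \in range h)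
    (y * \1_(h @^-1` [set y]) t * theta_weight t)%:E); last first.
  apply: eq_integral => t _; rewrite fsumEFin// -mulr_fsuml -EFinM; congr (_ * _)%:E.
  by rewrite -fimfunE.
rewrite ge0_integral_fsum//; last 2 first.
- move=> y; apply/measurable_EFinP; apply: measurable_funM; last exact: mw.
  by apply: measurable_funM; [exact: measurable_cst|exact: mi].
- move=> y t _; rewrite lee_fin mulr_ge0 ?theta_weight_ge0//.
  by have := nnfun_muleindic_ge0 h y t; rewrite -EFinM lee_fin.
apply: eq_fsbigr => y /[!inE] -[t0 _ <-]; set A := h @^-1` _.
have mA : measurable A by exact: measurable_sfunP.
under [RHS]eq_integral do rewrite -mulrA EFinM.
rewrite ge0_integralZl_EFin//; last 2 first.
- by move=> t _; rewrite lee_fin mulr_ge0 ?theta_weight_ge0.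
- by apply/measurable_EFinP; exact: measurable_funM.
congr (_ * _); rewrite -[LHS]/(\int[mu]_(t in A) (theta_weight t)%:E).
rewrite [LHS]integral_mkcond epatch_indic; by apply: eq_integral => t _; rewrite /= -EFinM mulrC.
Qed.

(** A pointwise bound on g times the weight suffices, as the parameter space has
    length 1.  The point 0, where theta_weight takes the meaningless value
    expR (- 0^-1) = 1, is discarded as a null set. *)
Lemma theta_mass_integral_le (g : R -> R) (M : R) : (0 <= M)%R ->
  (forall t, 0 <= g t)%R ->
  (forall t, t \in `]0, 1]%R -> g t * theta_weight t <= M)%R ->
  \int[@theta_mass R]_t (g t)%:E <= M%:E.
Proof.
move=> M0 g0 gM; apply: ge0_integral_le_nnsfun => [t|h hg]; first by rewrite lee_fin.
have mu01 : mu (`[0%R, 1%R] : set R) = 1.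
  by rewrite lebesgue_measure_itv/= lte_fin ltr01 -EFinB subr0.
rewrite nnsfun_theta_mass.
have mh : measurable_fun setT (fun t : R => (h t)%:E * (theta_weight t)%:E).
  apply/measurable_EFinP; apply: measurable_funM => //; exact: measurable_theta_weight.
apply: (@le_trans _ _ (\int[mu]_t ((M%:E * (\1_`[0%R, 1%R] t)%:E)))); last first.
  rewrite ge0_integralZl_EFin//; last first.
    by apply/measurable_EFinP; exact: measurable_indic.
  by rewrite integral_indic// setIT [X in _ * X]mu01 mule1.
apply: ae_ge0_le_integral => //.
- by move=> t _; rewrite mule_ge0 ?lee_fin ?theta_weight_ge0.
- by move=> t _; rewrite mule_ge0 ?lee_fin.
- by apply/measurable_EFinP; apply: measurable_funM => //; exact: measurable_indic.
exists [set 0%R]; split => //; first exact: lebesgue_measure_set1.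
move=> t /= nt; apply: contrapT => t0; apply: nt => _.
rewrite -!EFinM lee_fin indicE.
have [t01|t01] := boolP (t \in `[0%R, 1%R]%classic); last first.
  by rewrite mulr0 /theta_weight indicE (negbTE t01) !mulr0.
rewrite mulr1; apply: le_trans (gM t _).
  by rewrite ler_wpM2r ?theta_weight_ge0// -lee_fin.
move: t01; rewrite inE/= !in_itv/= => /andP[t1 ->]; rewrite andbT lt_neqAle t1 andbT.
by apply/eqP => /esym.
Qed.

Lemma theta_massT_le1 : @theta_mass R setT <= 1.
Proof.
rewrite -[leLHS]mul1e -integral_cst//.
apply: (@theta_mass_integral_le (cst 1%R)) => // t; rewrite in_itv/= => /andP[t0 t1].
rewrite mul1r /theta_weight mulr_ile1 ?expR_ge0//.
by rewrite -expR0 ler_expR oppr_le0 invr_ge0 ltW.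
Qed.

(** On [1/2, 1] the weight exp(-1/t) is at least exp(-2). *)
Lemma theta_massT_ge : (expR (-2) / 2)%:E <= @theta_mass R setT.
Proof.
rewrite /theta_mass.
apply: le_trans (_ : (expR (-2))%:E * mu (`[2^-1%R, 1%R] : set R) <= _).
  rewrite lebesgue_measure_itv/= lte_fin ifT; last lra.
  by rewrite -EFinB -EFinM lee_fin ler_wpM2l ?expR_ge0//; lra.
apply: indic_le_lower_integral => //.
- by move=> t; rewrite lee_fin theta_weight_ge0.
move=> t /=; rewrite in_itv/= => /andP[t0 t1].
rewrite lee_fin /theta_weight indicE mem_set ?mulr1; last first.
  by rewrite /= in_itv/= t1 andbT; lra.
by rewrite ler_expR lerN2 invf_ple// posrE; lra.
Qed.

Lemma theta_prior_integral_le (g : R -> R) (M : R) : (0 <= M)%R ->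
  measurable_fun setT g -> (forall t, 0 <= g t)%R ->
  (forall t, t \in `]0, 1]%R -> g t * theta_weight t <= M)%R ->
  \int[@theta_prior R]_t (g t)%:E <= (2 * expR 2 * M)%:E.
Proof.
move=> M0 mg g0 gM.
have k0 : 0 < @theta_mass R setT.
  by apply: lt_le_trans theta_massT_ge; rewrite lte_fin divr_gt0 ?expR_gt0.
have kfin : @theta_mass R setT \is a fin_num.
  by rewrite ge0_fin_numE ?(le_lt_trans theta_massT_le1 (ltry _))// ltW.
have kpos : (0 < fine (@theta_mass R setT))%R by rewrite -lte_fin fineK.
have K0 : (0 <= (fine (@theta_mass R setT))^-1)%R by rewrite invr_ge0 ltW.
have E A : theta_prior A = mscale (NngNum K0) (@theta_mass R) A.
  rewrite /theta_prior /mnormalize ifF ?/mscale/= 1?muleC//.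
  by rewrite gt_eqF//=; apply/negbTE; rewrite lt_eqF// (le_lt_trans theta_massT_le1)// ltry.
rewrite (eq_measure_integral (mscale (NngNum K0) (@theta_mass R))); last first.
  by move=> A mA _; exact: E.
rewrite ge0_integral_mscale//; last 2 first.
- exact/measurable_EFinP.
- by move=> t _; rewrite lee_fin.
rewrite EFinM lee_pmul//=.
- by apply: integral_ge0 => t _; rewrite lee_fin.
- rewrite lee_fin invf_ple ?posrE ?mulr_gt0 ?expR_gt0//.
  by rewrite -lee_fin fineK// (le_trans _ theta_massT_ge)// invfM expRN mulrC.
- exact: theta_mass_integral_le.
Qed.

End theta_integrals.

(** * Bounds on the posterior for a fixed sample *)

Section evidence.
Context {R : realType}.
Local Open Scope ereal_scope.

(** The first half of the prior is transported to the parameter interval, where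
    integrals can be computed. *)
Lemma ge0_prior_integral (h : density R -> R) : measurable_fun setT h ->
  (forall f, 0 <= h f)%R ->
  \int[@prior R]_f (h f)%:E = (2^-1)%:E * \int[@theta_prior R]_t (h (F0_param t))%:E +
    (2^-1)%:E * \int[@Pi_triangle R]_f (h f)%:E.
Proof.
move=> mh h0.
have mh' : measurable_fun setT (EFin \o h) by exact/measurable_EFinP.
have half0 : (0 <= 2^-1 :> R)%R by [].
rewrite (eq_measure_integral (measure_add (mscale (NngNum half0) (@Pi_0 R))
   (mscale (NngNum half0) (@Pi_triangle R)))); last first.
  by move=> A _ _; apply: esym; exact: measure_addE.
rewrite ge0_integral_measure_add//; last by move=> f _; rewrite lee_fin.
rewrite !ge0_integral_mscale//; try by move=> f _; rewrite lee_fin.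
congr (_ * _ + _ * _); rewrite /Pi_0 ge0_integral_pushforward// => f _.
by rewrite lee_fin.
Qed.

(** A simple function h below L is at most L o F0_param on the smooth part of the
    prior, and at most c on A and 0 off A almost everywhere for the discrete
    part; neither comparison needs L to be measurable. *)
Lemma prior_integral_le (L : density R -> R) (A : set (density R)) (c M : R) :
  (0 <= c)%R -> (0 <= M)%R -> (forall f : density R, 0 <= L f)%R ->
  A `<=` F_triangle \o @dens R ->
  (forall f : density R, A f -> L f = c) -> (forall f : density R, F_triangle f -> ~ A f -> L f = 0%R) ->
  (forall t, t \in `]0, 1]%R -> L (F0_param t) * theta_weight t <= M)%R ->
  \int[@prior R]_f (L f)%:E <=
   (expR 2 * M)%:E + (c / 2)%:E * Pi_triangle A.
Proof.
move=> c0 M0 L0 AT LA LnA LM.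
have mA : measurable A by exact: measurable_triangle.
apply: ge0_integral_le_nnsfun => [f|h hL]; first by rewrite lee_fin.
have mh : measurable_fun setT h by [].
rewrite ge0_prior_integral//; apply: leeD.
  rewrite (_ : (expR 2 * M)%:E = (2^-1)%:E * (2 * expR 2 * M)%:E); last first.
    by rewrite -EFinM !mulrA mulVf ?mul1r.
  rewrite lee_wpmul2l//; apply: theta_prior_integral_le => //.
    by apply: measurableT_comp => //; exact: measurable_F0_param.
  move=> t t01; apply: le_trans (LM t t01).
  by rewrite ler_wpM2r ?theta_weight_ge0// -lee_fin.
rewrite mulrC EFinM -muleA lee_wpmul2l//.
have -> : c%:E * Pi_triangle A = \int[@Pi_triangle R]_f (c%:E * (\1_A f)%:E).
  rewrite ge0_integralZl_EFin//; first by rewrite integral_indic// setIT.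
  by apply/measurable_EFinP; exact: measurable_indic.
apply: ae_ge0_le_integral => //.
- by move=> f _; rewrite lee_fin.
- exact/measurable_EFinP.
- by move=> f _; rewrite mule_ge0// lee_fin.
- by apply/measurable_EFinP; apply: measurable_funM => //; exact: measurable_indic.
exists [set f : density R | ~ F_triangle f]; split.
- have -> : [set f : density R | ~ F_triangle f] = ~` [set f : density R | F_triangle f] by [].
  by apply: measurableC; apply: measurable_triangle.
- exact: Pi_triangleC0.
move=> f /= nf Tf; apply: nf => _; apply: (le_trans (hL f)).
rewrite -EFinM lee_fin indicE; have [/set_mem Af|nAf] := boolP (f \in A).
  by rewrite mulr1 LA.
by rewrite mulr0 LnA// => Af; move: nAf; rewrite mem_set.
Qed.

Lemma prior_integral_ge (L : density R -> R) (A B : set (density R)) (c : R) :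
  (0 <= c)%R -> (forall f : density R, 0 <= L f)%R ->
  A `<=` F_triangle \o @dens R -> A `<=` B -> (forall f : density R, A f -> L f = c) ->
  (c / 2)%:E * Pi_triangle A <= \int[@prior R]_(f in B) (L f)%:E.
Proof.
move=> c0 L0 AT AB LA; rewrite integral_mkcond.
apply: (@le_trans _ _ (c%:E * prior A)).
  rewrite EFinM -muleA lee_wpmul2l//.
  by rewrite /prior leeDr// mule_ge0.
apply: indic_le_lower_integral => //; first exact: measurable_triangle.
  by move=> f; rewrite patchE; case: ifP => //; rewrite lee_fin.
by move=> f Af; rewrite patchE mem_set ?LA//; exact: AB.
Qed.

(** The convention for division makes this hold even if the evidence is 0 or
    infinite, so no sample has to be excluded. *)
Lemma posterior_le1 fstar (x : nat -> R) n (B : set (density R)) :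
  (forall f : density R, 0 <= likelihood_ratio fstar x n f)%R ->
  posterior fstar x n B <= 1.
Proof.
move=> L0; rewrite /posterior.
set num := \int[_]_(_ in B) _; set den := \int[_]_ _ _.
have h : num <= den.
  rewrite /num integral_mkcond; apply: ge0_le_lower_integral => f; rewrite patchE; case: ifP => //;
  by rewrite lee_fin.
have n0 : 0 <= num by apply: integral_ge0 => f _; rewrite lee_fin.
move: h n0; case: den => [den| |] h n0; last 2 first.
- by rewrite invey mule0.
- by move: h; rewrite leeNy_eq => /eqP h; rewrite h in n0.
move: h n0; case: num => [num| |]// h n0; rewrite inver; case: eqP => [den0|/eqP den0].
  have -> : num = 0%R by apply/eqP; rewrite eq_le -!lee_fin n0 andbT -den0.
  by rewrite mul0e.
have d0 : (0 < den)%R by rewrite lt_neqAle eq_sym den0 -lee_fin (le_trans n0).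
by rewrite -EFinM lee_fin ler_pdivrMr// mul1r -lee_fin.
Qed.

(** The discrete densities in A contribute at least p to the numerator and the
    smooth ones at most a multiple of M to the denominator; the contribution of
    A appears in both, and q / (a + q) increases with q. *)
Lemma posterior_ge fstar (x : nat -> R) n (A B : set (density R)) (c M p : R) :
  let L := likelihood_ratio fstar x n in
  (0 <= c)%R -> (0 <= M)%R -> (forall f : density R, 0 <= L f)%R ->
  A `<=` F_triangle \o @dens R -> A `<=` B ->
  (forall f : density R, A f -> L f = c) -> (forall f : density R, F_triangle f -> ~ A f -> L f = 0%R) ->
  (forall t, t \in `]0, 1]%R -> L (F0_param t) * theta_weight t <= M)%R ->
  (0 < p)%R -> p%:E <= (c / 2)%:E * Pi_triangle A ->
  (p / (expR 2 * M + p))%:E <= posterior fstar x n B.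
Proof.
move=> L c0 M0 L0 AT AB LA LnA LM p0 pA; rewrite /posterior.
have mA : measurable A by exact: measurable_triangle.
have hden := prior_integral_le c0 M0 L0 AT LA LnA LM.
have hnum := prior_integral_ge c0 L0 AT AB LA.
move: pA hden hnum; rewrite -[Pi_triangle A]fineK ?fin_num_measure// -EFinM -EFinD.
move: (c / 2 * _)%R => q pq hden hnum; rewrite lee_fin in pq.
have eM : (0 <= expR 2 * M)%R by rewrite mulr_ge0 ?expR_ge0.
apply: (@le_trans _ _ (q%:E * (expR 2 * M + q)%:E^-1)).
  rewrite inver gt_eqF -?EFinM ?lee_fin; last by lra.
  rewrite ler_pdivrMr 1?mulrAC ?ler_pdivlMr; [|lra..].
  by rewrite !mulrDr [(q * p)%R]mulrC lerD2r ler_wpM2r.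
apply: lee_pmul => //; first by rewrite lee_fin; lra.
  by rewrite inve_ge0 lee_fin; lra.
rewrite lee_pV2 //; rewrite inE; first by rewrite lee_fin; lra.
by apply: integral_ge0 => f _; rewrite lee_fin.
Qed.

End evidence.

(** * Moments of the standard normal law *)

Section normal_moments.
Context {R : realType}.
Local Notation N01 := (normal_prob (0:R) 1).
Local Open Scope ereal_scope.

Lemma sqr_le_exp (x : R) : (x ^+ 2 <= 2 * (expR x + expR (- x)))%R.
Proof.
have h : (x ^+ 2 <= 2 * expR `|x|)%R.
  have := expR_ge1Dxn 1 (normr_ge0 x); rewrite real_normK ?num_real// => h.
  by move: h; rewrite (_ : 2`! = 2)%N// => h; lra.
apply: (le_trans h); rewrite ler_pM2l//.
have [x0|x0] := leP 0%R x; first by rewrite ger0_norm// lerDl expR_ge0.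
by rewrite ltr0_norm// lerDr expR_ge0.
Qed.

Lemma measurable_expR_scale (c : R) : measurable_fun setT (fun x : R => expR (c * x)).
Proof. by apply: measurableT_comp => //; exact: measurable_funM. Qed.

Lemma integrable_expR_N01 (c : R) : N01.-integrable setT (fun x => (expR (c * x))%:E).
Proof.
apply/integrableP; split; first by apply/measurable_EFinP; exact: measurable_expR_scale.
under eq_integral do rewrite gee0_abs ?lee_fin ?expR_ge0//.
by rewrite integral_exp_N01 ltry.
Qed.

Lemma integral_sqr_N01_le : \int[N01]_x (x ^+ 2)%:E <= (4 * expR (2^-1))%:E.
Proof.
apply: (@le_trans _ _ (\int[N01]_x ((2%:E * (expR (1 * x))%:E) + 2%:E * (expR (-1 * x))%:E))).
  apply: ge0_le_lower_integral => x; first by rewrite lee_fin sqr_ge0.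
  by rewrite -!EFinM -EFinD lee_fin -mulrDr mul1r mulN1r sqr_le_exp.
have mE (c : R) : measurable_fun setT (fun x : R => (expR (c * x))%:E).
  by apply/measurable_EFinP; exact: measurable_expR_scale.
have mE2 (c : R) : measurable_fun setT (fun x : R => 2%:E * (expR (c * x))%:E).
  by apply: emeasurable_funM => //; exact: measurable_cst.
have pE (c x : R) : 0 <= 2%:E * (expR (c * x))%:E.
  by rewrite -EFinM lee_fin mulr_ge0 ?expR_ge0.
rewrite ge0_integralD//; [|exact: mE2..].
have iE (c : R) : \int[N01]_x (2%:E * (expR (c * x))%:E) = 2%:E * (expR (c ^+ 2 / 2))%:E.
  by rewrite ge0_integralZl_EFin ?integral_exp_N01//; exact: mE.
rewrite !iE -!EFinM -EFinD lee_fin expr1n sqrrN expr1n mul1r.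
by rewrite -mulrDl -natrD.
Qed.

Lemma integrable_sqr_N01 : N01.-integrable setT (fun x => (x ^+ 2)%:E).
Proof.
apply/integrableP; split.
  by apply/measurable_EFinP; exact: measurable_funX.
under eq_integral do rewrite gee0_abs ?lee_fin ?sqr_ge0//.
exact: le_lt_trans integral_sqr_N01_le (ltry _).
Qed.

Lemma integrable_id_N01 : N01.-integrable setT (fun x => x%:E).
Proof.
apply: (@le_integrable _ _ _ N01 _ _ _ (fun x => 1 + (x ^+ 2)%:E)) => //.
- by apply/measurable_EFinP; exact: measurable_id.
- move=> x _; rewrite -EFinD lee_fin [leRHS]ger0_norm ?addr_ge0 ?sqr_ge0//.
  by have := sqr_ge0 (`|x| - 1)%R; rewrite sqrrB real_normK ?num_real// expr1n mulr1; have := sqr_ge0 x; lra.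
apply: integrableD => //; last exact: integrable_sqr_N01.
exact: (finite_measure_integrable_cst N01 1).
Qed.

(** With m the mean, the inequality 1 + c x <= exp (c x) integrates to
    1 + c m <= exp (c^2 / 2) for all c.  The right side is 1 + O(c^2), so that
    c m <= c^2 for all small c of either sign, which forces m = 0. *)
Lemma integral_id_N01 : \int[N01]_x x%:E = 0.
Proof.
have fin := integrable_fin_num measurableT integrable_id_N01.
rewrite -(fineK fin); set m := fine _; congr EFin.
have h (c : R) : (1 + c * m <= expR (c ^+ 2 / 2))%R.
  rewrite -lee_fin -integral_exp_N01 EFinD EFinM /m fineK//.
  rewrite -integralZl//; last exact: integrable_id_N01.
  have i1 : N01.-integrable setT (cst 1%E) by exact: (finite_measure_integrable_cst N01 1).
  have -> : 1%:E = \int[N01]_x (cst 1 x).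
    by rewrite integral_cst// mul1e [RHS]probability_setT.
  rewrite -integralD//; last by apply: integrableZl => //; exact: integrable_id_N01.
  apply: le_integral => //.
  - by apply: integrableD => //; apply: integrableZl => //; exact: integrable_id_N01.
  - exact: integrable_expR_N01.
  - by move=> x _; rewrite /cst -EFinM -EFinD lee_fin expR_ge1Dx.
have h2 (c : R) : (`|c| <= 1 -> c * m <= c ^+ 2)%R.
  move=> c1; have c2 : (c ^+ 2 <= 1)%R by rewrite -real_normK ?num_real// expr_le1.
  have s0 := sqr_ge0 c; have := h c; set s := (c ^+ 2 / 2)%R => hc.
  have s1 : (1 - s <= expR (- s))%R by rewrite expR_ge1Dx.
  have s2 : (s <= 2^-1)%R by rewrite /s; lra.
  have s3 : (0 <= s)%R by rewrite /s; lra.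
  have s4 : (expR s * (1 - s) <= 1)%R.
    by rewrite -[leRHS](expRxMexpNx_1 s) ler_wpM2l ?expR_ge0.
  have s5 : (expR s <= 1 + 2 * s)%R.
    rewrite -(@ler_pM2r _ (1 - s)); last by lra.
    by apply: (le_trans s4); nra.
  by have -> : (c ^+ 2 = 2 * s)%R; [rewrite /s; field|lra].
apply/eqP/negP => /negP m0.
have a0 := normr_ge0 m.
(* A multiple of m so small that c * m <= c^2 is violated unless m = 0. *)
pose c := (m / (2 * (1 + `|m|)))%R.
have d0 : (0 < 2 * (1 + `|m|) :> R)%R by lra.
have c1 : (`|c| <= 1)%R.
  by rewrite /c normrM normfV (gtr0_norm d0) ler_pdivrMr// mul1r; lra.
have mE : (m = c * (2 * (1 + `|m|)))%R by rewrite /c divfK// gt_eqF.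
have := h2 c c1; have c0 : (c != 0)%R by apply: contraNneq m0 => c0; rewrite mE c0 mul0r.
have c2 : (0 < c ^+ 2)%R by rewrite exprn_even_gt0.
rewrite {1}mE mulrA -expr2 => h3.
have : (c ^+ 2 * (2 * (1 + `|m|)) <= c ^+ 2 * 1)%R by rewrite mulr1.
by rewrite ler_pM2l// => h4; lra.
Qed.

End normal_moments.

(** * The law of the normal scores *)

Section uniform_law.
Context {R : realType}.
Local Notation mu := (@lebesgue_measure R).
Local Notation N01 := (normal_prob (0:R) 1).

Lemma f_theta0 (x : R) : x \in `[0, 1[ -> f_theta 0 x = 1.
Proof.
move=> x01; rewrite /f_theta x01 mulr0 sqrtr0 mul0e oppr0 adde0.
by rewrite /= expR0.
Qed.

(** The end point 0, where the quantile function is infinite, is removed at no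
    cost. *)
Lemma law_of_f_theta0 (A : set R) : measurable A ->
  law_of_density (f_theta 0) A = mu (A `&` `]0, 1[).
Proof.
move=> mA; rewrite /law_of_density.
have m01 : measurable (A `&` `[0, 1[%classic : set R) by exact: measurableI.
rewrite (eq_integral (cst 1%E)); last by move=> x /[!inE] -[_ x01]; rewrite f_theta0.
rewrite integral_cst// mul1e.
have -> : A `&` `[0, 1[%classic = (A `&` `]0, 1[%classic) `|` (A `&` [set 0]).
  by rewrite -setIUr setUC setU1itv// bnd_simp.
apply: measureU0; [exact: measurableI|exact: measurableI|].
apply/eqP; rewrite eq_le measure_ge0 andbT -(@lebesgue_measure_set1 R 0).
by apply: le_measure; rewrite ?inE//; exact: measurableI.
Qed.

(** Truncation to ]0, 1[, where PhiInv is finite, makes the quantile function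
    measurable on the whole line. *)
Definition quantile01 : R -> R := quantile \_ (`]0, 1[ : set R).

Lemma quantile01E x : x \in `]0, 1[ -> quantile01 x = quantile x.
Proof. by move=> x01; rewrite /quantile01 patchE mem_set. Qed.

Lemma measurable_quantile01 : measurable_fun setT quantile01.
Proof. by apply/(measurable_restrictT quantile) => //; exact: measurable_qu. Qed.

HB.instance Definition _ := @isMeasurableFun.Build _ _ R R quantile01 measurable_quantile01.

Lemma N01_itv_gt (z : R) : N01 `]z, +oo[ = (1 - Phi z)%:E.
Proof.
rewrite -setCitvl; transitivity (1 - N01 `]-oo, z])%E; first exact: probability_setC.
by rewrite -[X in (_ - X)%E]fineK ?fin_num_measure// -EFinB.
Qed.

Lemma Phi_itv01 (z : R) : 0 <= Phi z <= 1.
Proof.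
rewrite /Phi fine_ge0//= -lee_fin fineK ?fin_num_measure//.
exact: probability_le1.
Qed.

(** Galois connection: quantile x <= z if and only if x <= Phi z, so the quantile
    of a uniform variable exceeds z with probability 1 - Phi z. *)
Lemma quantile01_itv_gt (z : R) :
  law_of_density (f_theta 0) (quantile01 @^-1` `]z, +oo[) = N01 `]z, +oo[.
Proof.
rewrite law_of_f_theta0; last first.
  by rewrite -[X in measurable X]setTI; exact: measurable_quantile01.
have /andP[P0 P1] := Phi_itv01 z.
have -> : quantile01 @^-1` `]z, +oo[ `&` `]0, 1[%classic = `]Phi z, 1[%classic.
  apply/seteqP; split => x /=.
    move=> [+ x01]; rewrite quantile01E// !in_itv/= andbT ltNge -lee_fin.
    rewrite fineK ?PhiInv_fin// PhiInv_le -ltNge => ->.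
    by move: x01; rewrite in_itv/= => /andP[].
  rewrite !in_itv/= => /andP[zx x1]; have x01 : x \in `]0, 1[.
    by rewrite in_itv/= x1 (le_lt_trans P0 zx).
  split; last by rewrite (le_lt_trans P0 zx) x1.
  by rewrite andbT quantile01E// ltNge -lee_fin fineK ?PhiInv_fin// PhiInv_le -ltNge.
rewrite N01_itv_gt lebesgue_measure_itv/= lte_fin; case: ltP => h.
  by rewrite -EFinB.
by congr EFin; lra.
Qed.

(** The half-lines ]z, +oo[ generate the Borel sets and are stable under
    intersection. *)
Lemma measure_unique_itv_gt (m : {measure set (measurableTypeR R) -> \bar R}) :
  (forall z : R, m `]z, +oo[%classic = N01 `]z, +oo[) -> forall A, measurable A -> m A = N01 A.
Proof.
move=> mE A mA.
apply: (@measure_unique _ R (measurableTypeR R) (@RGenOInfty.G R) (fun n => `]- n%:R, +oo[%classic)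
   _ _ _ _ m N01) => //.
- exact: RGenOInfty.measurableE.
- move=> _ _ [x ->] [y ->]; exists (Num.max x y); apply/seteqP; split => z /=.
    by rewrite !in_itv/= !andbT gt_max => -[-> ->].
  by rewrite !in_itv/= !andbT gt_max => /andP[-> ->].
- by move=> n; eexists.
- apply/seteqP; split => // x _; exists (Num.bound `|- x|) => //=.
  by rewrite in_itv/= andbT ltrNl (le_lt_trans _ (archi_boundP (normr_ge0 (- x))))// ?ler_norm.
- by move=> _ [z ->].
- by move=> k; rewrite mE N01_itv_gt ltry.
Qed.

End uniform_law.

(** * Random fluctuations of the sum of the scores *)

Section scores.
Context d (Omega : measurableType d) (R : realType) (P : probability Omega R).
Context (X : nat -> {RV P >-> R}) (hX : iid_from_density X (f_theta 0)).
Local Notation N01 := (normal_prob (0:R) 1).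
Local Open Scope ereal_scope.

(** The normal scores of the data: independent standard normal variables. *)
Definition score (i : nat) (w : Omega) : R := quantile01 (X i w).

Lemma measurable_score i : measurable_fun setT (score i).
Proof. by apply: measurableT_comp => //; exact: measurable_quantile01. Qed.

(** The Lebesgue and normal measures live on a copy of the reals with another
    display, which the scores have to take values in to be compared with them. *)
Let scoreR i : {mfun Omega >-> measurableTypeR R} :=
  HB.pack (score i : Omega -> measurableTypeR R)
    (@isMeasurableFun.Build _ _ Omega (measurableTypeR R) (score i) (measurable_score i)).

Lemma score_law i A : measurable A -> P (score i @^-1` A) = N01 A.
Proof.
move=> mA; apply: (@measure_unique_itv_gt R (pushforward P (scoreR i))) => // z.
rewrite -quantile01_itv_gt -(hX.2 i)//.
by rewrite -[X in measurable X]setTI; exact: measurable_quantile01.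
Qed.

Lemma prob_data_notin_itvoo i : P (X i @^-1` (~` `]0%R, 1%R[)) = 0.
Proof.
rewrite -[LHS]/(distribution P (X i) _) hX.2; last exact: measurableC.
by rewrite law_of_f_theta0 ?setICl ?measure0//; exact: measurableC.
Qed.

Lemma score_indep i j A B : i != j -> measurable A -> measurable B ->
  P (score i @^-1` A `&` score j @^-1` B) = N01 A * N01 B.
Proof.
move=> ij mA mB; rewrite -(score_law i mA) -(score_law j mB).
have mq C : measurable C -> measurable (@quantile01 R @^-1` C).
  by move=> mC; rewrite -[X in measurable X]setTI; exact: measurable_quantile01.
pose AB k := if k == i then @quantile01 R @^-1` A else @quantile01 R @^-1` B.
have := hX.1 [fset i; j]%fset AB.
rewrite (_ : \bigcap_(k in [set` [fset i; j]%fset]) (X k @^-1` AB k) =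
  score i @^-1` A `&` score j @^-1` B); last first.
  apply/seteqP; split => w /=.
    move=> h; split.
      by have := h i; rewrite /AB/= !inE eqxx; apply.
    by have := h j; rewrite /AB/= !inE eqxx orbT eq_sym (negbTE ij); apply.
  move=> [wA wB] k /=; rewrite !inE => /orP[] /eqP ->; rewrite /AB ?eqxx//.
  by rewrite eq_sym (negbTE ij).
move=> ->; last by move=> k; rewrite /AB; case: ifP => _; exact: mq.
rewrite big_fsetU1/= ?inE// big_seq_fset1 /AB eqxx eq_sym (negbTE ij)//.
Qed.

Lemma integral_score (f : R -> R) i : measurable_fun setT f -> (forall x, 0 <= f x)%R ->
  \int[P]_w (f (score i w))%:E = \int[N01]_x (f x)%:E.
Proof.
move=> mf f0.
rewrite -[RHS](@eq_measure_integral _ _ _ _ N01 (pushforward P (scoreR i))); last first.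
  by move=> A mA _; exact: score_law.
rewrite ge0_integral_pushforward//; first exact/measurable_EFinP.
by move=> y _; rewrite lee_fin.
Qed.

Lemma integrable_score_sqr i : P.-integrable setT (fun w => (score i w ^+ 2)%:E).
Proof.
apply/integrableP; split.
  by apply/measurable_EFinP; apply: measurable_funX; exact: measurable_score.
under eq_integral do rewrite gee0_abs ?lee_fin ?sqr_ge0//.
rewrite (@integral_score (fun x => x ^+ 2)%R)//.
- exact: le_lt_trans (@integral_sqr_N01_le R) (ltry _).
- by move=> x; exact: sqr_ge0.
Qed.

Lemma integral_score_sqr_le i :
  \int[P]_w (score i w ^+ 2)%:E <= (4 * expR (2^-1))%:E.
Proof.
rewrite (@integral_score (fun x => x ^+ 2)%R)//.
- exact: integral_sqr_N01_le.
- by move=> x; exact: sqr_ge0.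
Qed.

Lemma integrable_scoreM i j : P.-integrable setT (fun w => (score i w * score j w)%:E).
Proof.
apply: (@le_integrable _ _ _ P _ _ _ (fun w => (score i w ^+ 2)%:E + (score j w ^+ 2)%:E)) => //.
- by apply/measurable_EFinP; apply: measurable_funM; exact: measurable_score.
- move=> w _; rewrite -EFinD lee_fin [leRHS]ger0_norm ?addr_ge0 ?sqr_ge0//.
  move: (score i w) (score j w) => a b; rewrite ler_norml; apply/andP; split.
    by have := sqr_ge0 (a + b); have := sqr_ge0 a; have := sqr_ge0 b; nra.
  by have := sqr_ge0 (a - b); have := sqr_ge0 a; have := sqr_ge0 b; nra.
- by apply: integrableD => //; exact: integrable_score_sqr.
Qed.

(** The joint law of two scores is a product of normal laws, since it agrees with
    the product on rectangles; by Fubini the expectation of the product is then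
    the product of the means, which are 0. *)
Lemma integral_scoreM0 i j : i != j -> \int[P]_w (score i w * score j w)%:E = 0.
Proof.
move=> ij.
pose f (z : R * R) : \bar R := (z.1 * z.2)%:E.
have mf : measurable_fun [set: measurableTypeR R * measurableTypeR R] f.
  by apply/measurable_EFinP; apply: measurable_funM; [exact: measurable_fst|exact: measurable_snd].
pose U : Omega -> measurableTypeR R * measurableTypeR R := fun w => (score i w, score j w).
have mU : measurable_fun setT U.
  by apply/measurable_fun_pairP; split; exact: measurable_score.
pose UR : {mfun Omega >-> (measurableTypeR R * measurableTypeR R)%type} :=
  HB.pack U (@isMeasurableFun.Build _ _ Omega _ U mU).
have lawU : forall A, measurable A -> (N01 \x N01) A = pushforward P UR A.
  apply: product_measure_unique => A B mA mB.
  by rewrite -(score_indep ij mA mB).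
have mabs : measurable_fun [set: measurableTypeR R] (fun x : R => `|x|%:E).
  by apply/measurable_EFinP; exact: normr_measurable.
have [K K0 KE] : exists2 K : R, (0 <= K)%R & \int[N01]_x `|x|%:E = K%:E.
  have /integrableP[_ iid] := @integrable_id_N01 R.
  have f0 : 0 <= \int[N01]_x `|x|%:E by apply: integral_ge0 => x _; rewrite lee_fin.
  have ffin : \int[N01]_x `|x|%:E \is a fin_num by rewrite ge0_fin_numE.
  by exists (fine (\int[N01]_x `|x|%:E)); [exact: fine_ge0|rewrite fineK].
have intf : (N01 \x N01).-integrable setT f.
  have inner x : \int[N01]_y `|f (x, y)| = K%:E * `|x|%:E.
    transitivity (\int[N01]_y (`|x|%:E * `|y|%:E)).
      by apply: eq_integral => y _; rewrite /f abse_EFin normrM EFinM.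
    by rewrite ge0_integralZl_EFin// KE muleC.
  apply/(integrable12ltyP _ _ mf).
  under eq_integral do rewrite inner.
  by rewrite ge0_integralZl_EFin// KE -EFinM ltry.
transitivity (\int[pushforward P UR]_z f z).
  rewrite integral_pushforward//; exact: integrable_scoreM.
rewrite (eq_measure_integral (N01 \x N01)); last first.
  by move=> A mA _; apply/esym; exact: lawU.
rewrite -(integral12_prod_meas1 intf) /fubini_F /f/=.
rewrite integral0_eq// => x _.
under eq_integral do rewrite EFinM.
by rewrite integralZl// ?integral_id_N01 ?mule0//; exact: integrable_id_N01.
Qed.

(** Expanding the square, the mixed terms vanish by pairwise independence. *)
Lemma integral_sum_scores_sqr_le n :
  \int[P]_w ((\sum_(i < n) score i w) ^+ 2)%:E <= (n%:R * (4 * expR (2^-1)))%:E.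
Proof.
have -> : \int[P]_w ((\sum_(i < n) score i w) ^+ 2)%:E =
    \int[P]_w (\sum_(i < n) \sum_(j < n) (score i w * score j w)%:E).
  apply: eq_integral => w _; rewrite expr2 big_distrlr/= -sumEFin.
  by apply: eq_bigr => i _; rewrite sumEFin.
rewrite integral_sum//; last first.
  by move=> i; apply: integrable_sum => // j _; exact: integrable_scoreM.
have -> : (n%:R * (4 * expR (2^-1)))%:E = \sum_(i < n) (4 * expR (2^-1))%:E :> \bar R.
  by rewrite sumEFin sumr_const card_ord mulr_natl.
apply: lee_sum => i _; rewrite integral_sum//; last first.
  by move=> j; exact: integrable_scoreM.
rewrite (bigD1 i)//= big1 ?adde0; first exact: integral_score_sqr_le.
by move=> j ji; rewrite integral_scoreM0// (inj_eq val_inj) eq_sym.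
Qed.

Lemma measurable_sum_scores n : measurable_fun setT (fun w => (\sum_(i < n) score i w)%R).
Proof.
by apply: measurable_sum => i; exact: measurable_score.
Qed.

(** Chebyshev's inequality. *)
Lemma sum_scores_tail n (a : R) : (0 < a)%R ->
  P [set w | (a < \sum_(i < n) score i w)%R] <= (n%:R * (4 * expR (2^-1)) / a ^+ 2)%:E.
Proof.
move=> a0; rewrite EFinM lee_pdivlMr ?exprn_gt0// muleC.
apply: le_trans (integral_sum_scores_sqr_le n).
apply: indic_le_lower_integral.
- rewrite -[X in measurable X]setTI.
  rewrite (_ : [set w | _] = (fun w => (\sum_(i < n) score i w)%R) @^-1` `]a, +oo[); last first.
    by apply/seteqP; split => w /=; rewrite in_itv/= andbT.
  exact: measurable_sum_scores.
- by rewrite exprn_ge0// ltW.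
- by move=> w; rewrite lee_fin sqr_ge0.
- by move=> w /= aw; rewrite lee_fin ler_sqr ?nnegrE ?(ltW aw)//; lra.
Qed.

(** Along n = m^4 the probability that the sum exceeds n^(3/4) = m^3 is
    O(m^4 / m^6) = O(1 / m^2).  For this to happen for every m >= k has a
    probability below each of these bounds, hence 0. *)
Lemma sum_scores_often_small :
  {ae P, forall w, forall k, exists2 m, (k <= m)%N &
     (\sum_(i < m ^ 4) score i w <= m%:R ^+ 3)%R}.
Proof.
apply: ae_foralln => k.
pose B m := [set w | (m%:R ^+ 3 < \sum_(i < m ^ 4) score i w)%R].
have mB m : measurable (B m).
  rewrite -[X in measurable X]setTI.
  rewrite (_ : B m = (fun w => (\sum_(i < m ^ 4) score i w)%R) @^-1` `](m%:R ^+ 3)%R, +oo[); last first.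
    by apply/seteqP; split => w /=; rewrite in_itv/= andbT.
  exact: measurable_sum_scores.
pose C := (4 * expR (2^-1) : R)%R.
have PB m : (0 < m)%N -> P (B m) <= (C / m%:R ^+ 2)%:E.
  move=> m0; have m0' : (0 < m%:R :> R)%R by rewrite ltr0n.
  have := @sum_scores_tail (m ^ 4) (m%:R ^+ 3) (exprn_gt0 _ m0').
  rewrite -/C natrX (_ : (m%:R ^+ 4 * C / m%:R ^+ 3 ^+ 2)%R = (C / m%:R ^+ 2)%R)//.
  by field; rewrite gt_eqF.
exists (\bigcap_(m in [set m | (k <= m)%N]) B m); split.
- by apply: bigcap_measurableType => m _; exact: mB.
- apply/eqP; rewrite eq_le measure_ge0 andbT; apply/lee_addgt0Pr => e e0.
  rewrite add0e.
  have C0 : (0 < C)%R by rewrite mulr_gt0 ?expR_gt0.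
  pose m := (maxn k (Num.bound (C / e)).+1).
  have m0 : (0 < m)%N by rewrite /m leq_max orbT.
  apply: (@le_trans _ _ (P (B m))).
    apply: le_measure; rewrite ?inE//; first by apply: bigcap_measurableType => j _; exact: mB.
    by move=> w; apply; rewrite /= leq_maxl.
  apply: (le_trans (PB m m0)); rewrite lee_fin ler_pdivrMr ?exprn_gt0 ?ltr0n//.
  have h : (C / e < m%:R)%R.
    apply: (lt_le_trans (archi_boundP _)); first by rewrite divr_ge0//; exact: ltW.
    by rewrite ler_nat (leq_trans (leqnSn _))// leq_maxr.
  rewrite mulrC -ler_pdivrMr// (le_trans (ltW h))// expr2 ler_peMr ?ler1n//.
- move=> w /= nw m /= km; rewrite /B/= ltNge; apply/negP => h; apply: nw.
  by exists m.
Qed.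

Lemma data_in_itvoo_ae : {ae P, forall w, forall i, X i w \in `]0%R, 1%R[}.
Proof.
apply: ae_foralln => i; exists (X i @^-1` (~` `]0%R, 1%R[)); split => //.
- by rewrite -[X in measurable X]setTI; apply: measurable_funP => //; exact: measurableC.
- exact: prob_data_notin_itvoo.
Qed.

End scores.

(** * Asymptotic estimates *)

Section limsup.
Context {R : realType}.

(** Reaching 1 up to e arbitrarily late is enough, because no value exceeds 1. *)
Lemma limn_esup_eq1 (u : (\bar R)^nat) : (forall n, (u n <= 1)%E) ->
  (forall e : R, 0 < e -> forall k, exists2 n, (k <= n)%N & ((1 - e)%:E <= u n)%E) ->
  limn_esup u = 1%E.
Proof.
move=> u1 h; apply/eqP; rewrite eq_le; apply/andP; split.
  apply: (@le_trans _ _ (ereal_sup (range u))).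
    by apply: ereal_inf_lbound; exists setT => //; exact: filterT.
  by apply: ge_ereal_sup => _ [n _ <-].
apply: le_ereal_inf_tmp => _ [V [k _ kV] <-].
apply/lee_subgt0Pr => e e0; rewrite -EFinB.
have [n kn un] := h e e0 k.
apply: (le_trans un); apply: ereal_sup_ubound; exists n => //.
exact: kV.
Qed.

(** The exponent of the integrand of the smooth part of the evidence for n = m^4
    data points with sum of scores S.  The score term is absorbed by half of the
    drift -n t up to m^2, and the other half of the drift plus the exponent
    -1/t of the prior is at most -sqrt(2 n) = -sqrt 2 m^2, of which
    -4/3 m^2 is kept. *)
Lemma laplace_exponent (m S t : R) : 0 < t -> 0 <= m -> S <= m ^+ 3 ->
  - (m ^+ 4 * t) + Num.sqrt (2 * t) * S - t^-1 <= - (m ^+ 2 / 3).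
Proof.
move=> t0 m0 Sm; have u0 := sqrtr_ge0 (2 * t).
have u2 : Num.sqrt (2 * t) ^+ 2 = 2 * t by rewrite sqr_sqrtr// mulr_ge0// ltW.
have := ler_wpM2l u0 Sm; move: u0 u2; set u := Num.sqrt _ => u0 u2 h1.
have h2 : u * m ^+ 3 <= m ^+ 4 * t / 2 + m ^+ 2.
  (* The arithmetic-geometric inequality for m^2 u / 2 and m, where u^2 = 2t. *)
  have := sqr_ge0 (m ^+ 2 * u / 2 - m).
  rewrite (_ : (_ - _) ^+ 2 = m ^+ 4 * u ^+ 2 / 4 - u * m ^+ 3 + m ^+ 2); last by field.
  by rewrite u2; lra.
have h3 : 4 / 3 * m ^+ 2 <= m ^+ 4 * t / 2 + t^-1.
  rewrite -(ler_pM2r t0) [leRHS]mulrDl mulVf ?gt_eqF//.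
  (* Multiplied by t this is a quadratic in m^2 t without real roots. *)
  have := sqr_ge0 (m ^+ 2 * t - 4 / 3).
  rewrite (_ : (_ - _) ^+ 2 = m ^+ 4 * t ^+ 2 - 8 / 3 * (m ^+ 2 * t) + 16 / 9); last by field.
  by rewrite (_ : m ^+ 4 * t / 2 * t = m ^+ 4 * t ^+ 2 / 2); [lra|field].
lra.
Qed.

Lemma expRN_le_inv_pow5 (y : R) : 0 < y -> expR (- y) <= 120 / y ^+ 5.
Proof.
move=> y0; rewrite expRN invf_ple ?posrE ?divr_gt0 ?exprn_gt0 ?expR_gt0// invf_div.
have := expR_ge1Dxn 4 (ltW y0); rewrite (_ : 5`! = 120)%N// => h; lra.
Qed.

End limsup.

(** * Likelihood ratios against the uniform density *)

Section likelihoods.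
Context {R : realType}.
Context (x : nat -> R) (n : nat) (x01 : forall i, x i \in `]0, 1[).
Local Notation L := (likelihood_ratio (f_theta 0) x n).

Lemma data_in_itvco i : x i \in `[0, 1[.
Proof. by have := x01 i; rewrite !in_itv/= => /andP[/ltW -> ->]. Qed.

Lemma likelihood_ratioE (f : density R) : L f = \prod_(i < n) f (x i).
Proof. by apply: eq_bigr => i _; rewrite f_theta0 ?data_in_itvco// divr1. Qed.

Lemma likelihood_ratio_ge0 (f : density R) : 0 <= L f.
Proof. by rewrite likelihood_ratioE; apply: prodr_ge0 => i _; exact: density_ge0. Qed.

(** A Gaussian shift family in the scores: the likelihood depends on the data only
    through the sum of the scores. *)
Lemma likelihood_ratio_f_theta (t : R) : t \in `]0, 1] ->
  L (F0_param t) =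
  expR (- (n%:R * t) + Num.sqrt (2 * t) * \sum_(i < n) quantile (x i)).
Proof.
rewrite in_itv/= => /andP[t0 t1].
have ct : clamp t = t by rewrite /clamp (min_idPl t1) (max_idPr (ltW t0)).
transitivity (expR (\sum_(i < n) (- t + Num.sqrt (2 * t) * quantile (x i)))).
  rewrite likelihood_ratioE expR_sum; apply: eq_bigr => i _.
  by rewrite /F0_param /dens /= ct f_thetaE.
congr expR; rewrite big_split/= sumr_const card_ord -mulr_sumr.
by congr (_ + _); rewrite [n%:R * t]mulr_natl mulNrn.
Qed.

Lemma triangle_values (f : density R) y : F_triangle f -> f y != 2 -> f y = 0.
Proof.
move=> [N _ [S _ <-]]; rewrite /two_on indicE; case: (_ \in _); rewrite ?mulr0// mulr1.
by rewrite eqxx.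
Qed.

Lemma likelihood_ratio_covering (f : density R) :
  (forall i : 'I_n, f (x i) = 2) -> L f = 2 ^+ n.
Proof.
move=> h; rewrite likelihood_ratioE (eq_bigr (fun=> 2)) => [|i _]; last exact: h.
by rewrite prodr_const card_ord.
Qed.

Lemma likelihood_ratio_not_covering (f : density R) : F_triangle f ->
  ~ (forall i : 'I_n, f (x i) = 2) -> L f = 0.
Proof.
move=> Tf /existsNP[i /eqP fi]; rewrite likelihood_ratioE (bigD1 i)//=.
by rewrite (triangle_values Tf fi) mul0r.
Qed.

End likelihoods.

(** * Inconsistency *)

(** For n = m^4 data points whose scores sum to at most m^3, the discrete part
    contributes at least 1 / (8 n^2) = 1 / (8 m^8), while the smooth part
    contributes at most exp(2 - m^2 / 3), which is at most a constant times
    1 / m^10.  The quotient of the two is O(1 / m^2). *)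
Lemma posterior_power2_ge (R : realType) (x : nat -> R) (m : nat) :
  (forall i, x i \in `]0, 1[) -> (0 < m)%N ->
  \sum_(i < m ^ 4) quantile (x i) <= m%:R ^+ 3 ->
  ((1 - 8 * 120 * 3 ^+ 5 * expR 2 / m%:R ^+ 2)%:E <=
   posterior (f_theta 0) x (m ^ 4)
    [set f : density R | likelihood_ratio (f_theta 0) x (m ^ 4) f = (2 ^+ (m ^ 4))%R])%E.
Proof.
move=> x01 m0 Sm; set n := (m ^ 4)%N; set B := [set f | _].
have n0 : (0 < n)%N by rewrite expn_gt0 m0.
have mR : 0 < m%:R :> R by rewrite ltr0n.
pose A := [set f : density R | F_triangle f /\ forall i : 'I_n, f (x i) = 2].
pose p : R := (8 * n%:R ^+ 2)^-1.
have p0 : 0 < p by rewrite invr_gt0 mulr_gt0// exprn_gt0// ltr0n.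
have pA : (p%:E <= (2 ^+ n / 2)%:E * Pi_triangle A)%E.
  apply: (@le_trans _ _ ((2 ^+ n / 2)%:E * (2 ^- n / (4 * n%:R ^+ 2))%:E)%E).
    rewrite -EFinM lee_fin /p le_eqVlt; apply/orP; left; apply/eqP.
    have nR : n%:R != 0 :> R by rewrite pnatr_eq0 -lt0n.
    have q0 : 2 ^+ n != 0 :> R by rewrite expf_neq0.
    by move: (2 ^+ n) q0 => q q0; field; rewrite ?nR ?q0.
  by rewrite lee_wpmul2l// ?lee_fin//; apply: Pi_triangle_covering => // i; exact: data_in_itvco.
have := @posterior_ge R (f_theta 0) x n A B (2 ^+ n) (expR (- (m%:R ^+ 2 / 3))) p.
move=> /(_ _ _ _ _ _ _ _ _ p0 pA) H.
apply: le_trans (H _ _ _ _ _ _ _ _) => {H} //.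
- rewrite lee_fin ler_pdivlMr; last by rewrite addr_gt0// mulr_gt0 ?expR_gt0.
  set E := expR 2; set M := expR _; set D := 8 * 120 * 3 ^+ 5 * E / m%:R ^+ 2.
  have E0 : 0 < E by exact: expR_gt0.
  have M0 : 0 < M by exact: expR_gt0.
  have D0 : 0 <= D by rewrite divr_ge0// ?mulr_ge0// ?exprn_ge0// ltW.
  have EM : E * M <= D * p.
    have M1 : M <= 120 / (m%:R ^+ 2 / 3) ^+ 5.
      by apply: expRN_le_inv_pow5; rewrite divr_gt0// exprn_gt0.
    apply: (le_trans (ler_wpM2l (ltW E0) M1)).
    rewrite /D /p /n natrX le_eqVlt; apply/orP; left; apply/eqP.
    by field; rewrite gt_eqF.
  have DEM : 0 <= D * (E * M) by rewrite mulr_ge0// mulr_ge0// ltW.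
  by rewrite mulrBl mul1r mulrDr; lra.
- by move=> f; exact: likelihood_ratio_ge0.
- by move=> f [].
- by move=> f [_ h]; exact: likelihood_ratio_covering.
- by move=> f [_ h]; exact: likelihood_ratio_covering.
- by move=> f Tf nA; apply: likelihood_ratio_not_covering => // h; apply: nA.
- move=> t t01; rewrite likelihood_ratio_f_theta// /theta_weight indicE mem_set; last first.
    by move: t01; rewrite /= !in_itv/= => /andP[/ltW -> ->].
  rewrite mulr1 -expRD ler_expR natrX.
  by apply: laplace_exponent => //; move: t01; rewrite in_itv/= => /andP[].
Qed.

Theorem theorem2 (R : realType) (d : measure_display)
    (Omega : measurableType d) (P : probability Omega R)
    (X : nat -> {RV P >-> R})
    (hX : iid_from_density X (f_theta 0)) :
  gamma_inconsistent X (f_theta 0) (ln 2) /\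
  {ae P, forall w, limn_esup (fun n =>
     posterior (f_theta 0) (X ^~ w) n
       [set f : density R | likelihood_ratio (f_theta 0) (X ^~ w) n f = 2 ^+ n])
   = 1%E}.
Proof.
(* Both claims are instances, as exp (n ln 2) = 2^n. *)
have H (c : nat -> R) : (forall n, c n = 2 ^+ n) ->
  {ae P, forall w, limn_esup (fun n => posterior (f_theta 0) (X ^~ w) n
     [set f : density R | likelihood_ratio (f_theta 0) (X ^~ w) n f = c n]) = 1%E}; last first.
  split; apply: H => n //.
  by rewrite mulrC expRM_natl lnK// posrE.
move=> cE; have := data_in_itvoo_ae hX; have := sum_scores_often_small hX.
apply: filterS2 => w often w01.
apply: limn_esup_eq1 => [n|e e0 k].
  by apply: posterior_le1 => f; exact: likelihood_ratio_ge0.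
pose D : R := 8 * 120 * 3 ^+ 5 * expR 2.
have D0 : 0 < D by rewrite mulr_gt0 ?expR_gt0// mulr_gt0// exprn_gt0.
have [m + Sm] := often (maxn k (Num.bound (D / e)).+1).
rewrite geq_max => /andP[km bm].
have m0 : (0 < m)%N by exact: leq_ltn_trans bm.
exists (m ^ 4)%N; first by rewrite (leq_trans km)// -{1}(expn1 m) leq_pexp2l.
rewrite cE; apply: le_trans (@posterior_power2_ge R (X ^~ w) m w01 m0 _); last first.
  by apply: le_trans Sm; apply: ler_sum => i _; rewrite /score quantile01E.
rewrite lee_fin lerD2l lerN2 -/D ler_pdivrMr ?exprn_gt0 ?ltr0n//.
have h : D / e < m%:R.
  apply: (lt_le_trans (archi_boundP _)); first by rewrite divr_ge0//; exact: ltW.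
  by rewrite ler_nat ltnW.
by rewrite mulrC -ler_pdivrMr// (le_trans (ltW h))// expr2 ler_peMr ?ler1n.
Qed.
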